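(* Let $N^n$ be a finite-dimensional affine Poisson manifold with affine coordinates $u^1,\dots,u^n$ and Poisson bi-vector $\mathcal{P}=(\mathcal{P}^{ij})$, $\mathcal{P}^{ij}=-\mathcal{P}^{ji}$. Let $\star$ be the Kontsevich star-product expanded up to $\bar{o}(\hbar^3)$ as in the context, and let $\mathsf{A}$ be the sum of the $39$ terms (graphs) at $\hbar^3$ which remain in the associator $$\mathsf{Assoc}(f,g,h)=(f\star g)\star h-f\star(g\star h)$$ after similar terms are collected by using the skew-symmetry $\mathcal{P}^{ij}=-\mathcal{P}^{ji}$. Then $\mathsf{A}$ vanishes by virtue of the restrictions of $S_f,S_g,S_h$ and $I_f,I_g,I_h$ (the vanishing differential consequences of the Jacobi identity which are defined in the context) to the differential orders $(i,j,k)$ that are present in $\mathsf{A}$. Indeed, with $\stackrel{[m]}{=}$ indicating the number $m$ of terms eliminated at each step, one has $$\mathsf{A}_{221}\stackrel{[3]}{=}\tfrac23(S_f)_{221},\qquad \mathsf{A}_{122}\stackrel{[3]}{=}\tfrac23(S_g)_{122},\qquad \mathsf{A}_{212}\stackrel{[3]}{=}-\tfrac23(S_h)_{212},$$ $$\mathsf{A}_{111}\stackrel{[8]}{=}\tfrac16(I_f-I_h)_{111},\qquad \mathsf{A}_{112}\stackrel{[9]}{=}\bigl(\tfrac16I_f+\tfrac16I_g-\tfrac13S_h\bigr)_{112},$$ $$\mathsf{A}_{121}\stackrel{[4]}{=}\tfrac13(I_f-I_h)_{121},\qquad \mathsf{A}_{211}\stackrel{[9]}{=}\bigl(\tfrac13S_f-\tfrac16I_g-\tfrac16I_h\bigr)_{211}.$$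 The total number of terms thus eliminated equals $(3+3+3)+8+9+4+9=39$.
   Context: Summation over repeated indices from $1$ to $n$ is implicit; $\partial_i=\partial/\partial u^i$; $f,g,h\in C^\infty(N^n)$. **Bracket and Jacobiator.** $\{a,b\}_{\mathcal{P}}=\mathcal{P}^{ij}\,\partial_i a\,\partial_j b$ and $$\operatorname{Jac}_{\mathcal{P}}(a,b,c)=\{\{a,b\}_{\mathcal{P}},c\}_{\mathcal{P}}-\{\{a,c\}_{\mathcal{P}},b\}_{\mathcal{P}}-\{a,\{b,c\}_{\mathcal{P}}\}_{\mathcal{P}},$$ which is zero as $\mathcal{P}$ is Poisson. The components $\mathcal{P}^{ij}$ and their derivatives may also be inserted as scalar arguments of $\operatorname{Jac}_{\mathcal{P}}$. **The star-product up to $\bar{o}(\hbar^3)$.** $f\star g=B_0(f,g)+\hbar B_1(f,g)+\hbar^2B_2(f,g)+\hbar^3B_3(f,g)+\bar{o}(\hbar^3)$, extended $\hbar$-linearly, where $B_0(f,g)=fg$, $B_1(f,g)=\mathcal{P}^{ij}\,\partial_i f\,\partial_j g$, $$B_2(f,g)=\tfrac12\mathcal{P}^{ij}\mathcal{P}^{kl}\,\partial_i\partial_k f\,\partial_j\partial_l g+\tfrac13\bigl(\mathcal{P}^{kl}\,\partial_l\mathcal{P}^{ij}\,\partial_i\partial_k f\,\partial_j g+\mathcal{P}^{kl}\,\partial_k\mathcal{P}^{ij}\,\partial_i f\,\partial_j\partial_l g\bigr)+\tfrac16\,\partial_k\mathcal{P}^{ij}\,\partial_j\mathcal{P}^{kl}\,\partial_i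 f\,\partial_l g,$$ $$\begin{aligned}B_3(f,g)={}&\tfrac16\Bigl(\mathcal{P}^{ij}\mathcal{P}^{kl}\mathcal{P}^{pq}\,\partial_i\partial_k\partial_p f\,\partial_j\partial_l\partial_q g+\mathcal{P}^{pq}\,\partial_k\partial_p\mathcal{P}^{ij}\,\partial_j\partial_q\mathcal{P}^{kl}\,\partial_i f\,\partial_l g\\&+\mathcal{P}^{pq}\,\partial_k\mathcal{P}^{ij}\,\partial_j\mathcal{P}^{kl}\,\partial_i\partial_p f\,\partial_l\partial_q g+\mathcal{P}^{pq}\,\partial_p\mathcal{P}^{kl}\,\partial_q\partial_l\mathcal{P}^{ij}\,\partial_i\partial_k f\,\partial_j g\\&+\mathcal{P}^{pq}\,\partial_p\partial_k\mathcal{P}^{ij}\,\partial_q\mathcal{P}^{kl}\,\partial_i f\,\partial_j\partial_l g+\mathcal{P}^{kl}\mathcal{P}^{pq}\,\partial_l\partial_q\mathcal{P}^{ij}\,\partial_i\partial_k\partial_p f\,\partial_j g\\&+\mathcal{P}^{kl}\mathcal{P}^{pq}\,\partial_k\partial_p\mathcal{P}^{ij}\,\partial_i f\,\partial_j\partial_l\partial_q g\Bigr)\\&+\tfrac13\Bigl(\mathcal{P}^{pq}\mathcal{P}^{kl}\,\partial_l\mathcal{P}^{ij}\,\partial_i\partial_k\partial_p f\,\partial_j\partial_q g+\mathcal{P}^{pq}\mathcal{P}^{kl}\,\partial_k\mathcal{P}^{ij}\,\partial_i\partial_p f\,\partial_j\partial_l\partial_q g\Bigr)\\&+\tfrac16\Bigl(\mathcal{P}^{pq}\,\partial_k\mathcal{P}^{ij}\,\partial_q\partial_j\mathcal{P}^{kl}\,\partial_i\partial_p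 f\,\partial_l g+\mathcal{P}^{pq}\,\partial_p\partial_k\mathcal{P}^{ij}\,\partial_j\mathcal{P}^{kl}\,\partial_i f\,\partial_l\partial_q g\\&+\mathcal{P}^{pq}\,\partial_q\mathcal{P}^{kl}\,\partial_k\mathcal{P}^{ij}\,\partial_i\partial_p f\,\partial_j\partial_l g+\mathcal{P}^{pq}\,\partial_p\mathcal{P}^{kl}\,\partial_l\mathcal{P}^{ij}\,\partial_i\partial_k f\,\partial_j\partial_q g\Bigr).\end{aligned}$$ **Differential consequences of the Jacobi identity** (tri-differential operators in $f,g,h$, all equal to zero; the outer derivative acts by the Leibniz rule on everything inside its argument): $$S_f=\mathcal{P}^{ij}\,\partial_j\operatorname{Jac}_{\mathcal{P}}(\partial_i f,g,h)=0,\quad S_g=\mathcal{P}^{ij}\,\partial_j\operatorname{Jac}_{\mathcal{P}}(f,\partial_i g,h)=0,\quad S_h=\mathcal{P}^{ij}\,\partial_j\operatorname{Jac}_{\mathcal{P}}(f,g,\partial_i h)=0,$$ $$I_f=\partial_j\bigl(\operatorname{Jac}_{\mathcal{P}}(\mathcal{P}^{ij},g,h)\bigr)\partial_i f=0,\quad I_g=\partial_j\bigl(\operatorname{Jac}_{\mathcal{P}}(f,\mathcal{P}^{ij},h)\bigr)\partial_i g=0,\quad I_h=\partial_j\bigl(\operatorname{Jac}_{\mathcal{P}}(f,g,\mathcal{P}^{ij})\bigr)\partial_i h=0.$$ In the expansion of $I_f$ the three tadpole terms (the outer derivative falling on $\mathcal{P}^{ij}$ inside the Jacobiator) produce $\operatorname{Jac}_{\mathcal{P}}(\partial_i\mathcal{P}^{ij},g,h)\,\partial_j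 f=0$ (up to sign), which itself vanishes by the Jacobi identity, and similarly for $I_h$; this plays its role in the identity for $\mathsf{A}_{111}$, where these tadpole terms are dropped. **Restriction to a differential order.** For a tri-differential operator $X=\sum_{I,J,K}c^{IJK}\,\partial_I\otimes\partial_J\otimes\partial_K$ (multi-indices $I,J,K$) acting on $(f,g,h)$, its restriction to differential order $(i,j,k)$ is $X_{ijk}=\sum_{|I|=i,|J|=j,|K|=k}c^{IJK}\,\partial_I\otimes\partial_J\otimes\partial_K$. If $X$ vanishes identically, so does every $X_{ijk}$. *)

(* Defs.v *)
From HB Require Import structures.
From mathcomp Require Import all_boot all_order all_algebra.
From mathcomp Require Import all_classical all_reals all_analysis.

Set Implicit Arguments.
Unset Strict Implicit.
Unset Printing Implicit Defensive.

Import Order.TTheory GRing.Theory Num.Theory.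
Import numFieldNormedType.Exports.

Local Open Scope classical_set_scope.
Local Open Scope ring_scope.

(* [icoord] is the inverse of [coord : dom -> coord @` dom]; both functions are
   total and are only meaningful on these two open sets. *)
Record chart (R : realType) (n : nat) (M : topologicalType) := Chart {
  dom : set M;
  coord : M -> 'rV[R]_n;
  icoord : 'rV[R]_n -> M;
  dom_open : open dom;
  coord_open : open (coord @` dom);
  coordK : forall x, dom x -> icoord (coord x) = x;
  coord_continuous : forall x, dom x -> {for x, continuous coord};
  icoord_continuous :
    forall v, (coord @` dom) v -> {for v, continuous icoord} }.

Record affine_manifold (R : realType) (n : nat) := AffineManifold {
  points :> topologicalType;
  points_hausdorff : hausdorff_space points;
  points_second_countable : @second_countable points;
  atlas : set (chart R n points);
  atlas_cover : forall x : points, exists2 c, atlas c & dom c x;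
  atlas_affine : forall c c', atlas c -> atlas c' ->
    forall x : points, dom c x -> dom c' x ->
    exists (L : 'M[R]_n) (b : 'rV[R]_n),
      \forall v \near coord c x, coord c' (icoord c v) = v *m L + b }.

(* The partial derivative with respect to the coordinate [u^i] of the chart. *)
Definition pd (R : realType) (n : nat) (N : affine_manifold R n)
    (c : chart R n N) (i : 'I_n) (f : N -> R) : N -> R :=
  fun x => 'D_(delta_mx 0 i) (f \o icoord c) (coord c x).

Definition pds (R : realType) (n : nat) (N : affine_manifold R n)
    (c : chart R n N) (l : seq 'I_n) (f : N -> R) : N -> R :=
  foldr (pd c) f l.

(* [f] is C^infinity on the domain of the chart [c]; in particular, this holds
   for the restriction to [dom c] of every smooth function on [N]. *)
Definition smooth_on (R : realType) (n : nat) (N : affine_manifold R n)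
    (c : chart R n N) (f : N -> R) : Prop :=
  forall (l : seq 'I_n) (x : N), dom c x ->
    {for x, continuous (pds c l f)} /\
    forall i : 'I_n,
      derivable (pds c l f \o icoord c) (coord c x) (delta_mx 0 i).

Record bivector (R : realType) (n : nat) (N : affine_manifold R n) := Bivector {
  bcomp :> chart R n N -> 'I_n -> 'I_n -> N -> R;
  bcomp_smooth : forall c i j, atlas c -> smooth_on c (bcomp c i j);
  bcomp_skew : forall c i j x, atlas c -> dom c x ->
    bcomp c i j x = - bcomp c j i x;
  bcomp_tensor : forall c c' k l x, atlas c -> atlas c' ->
    dom c x -> dom c' x ->
    bcomp c' k l x = \sum_i \sum_j bcomp c i j x *
      pd c i (fun y => coord c' y 0 k) x * pd c j (fun y => coord c' y 0 l) x }.

Definition bracket (R : realType) (n : nat) (N : affine_manifold R n)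
    (P : bivector N) (c : chart R n N) (a b : N -> R) : N -> R :=
  \sum_i \sum_j P c i j * pd c i a * pd c j b.

Definition Jac (R : realType) (n : nat) (N : affine_manifold R n)
    (P : bivector N) (c : chart R n N) (a b d : N -> R) : N -> R :=
  bracket P c (bracket P c a b) d - bracket P c (bracket P c a d) b
  - bracket P c a (bracket P c b d).

(* The arguments range over all functions which are smooth on the chart, as
   components of [P] and their derivatives are also inserted in [Jac]. *)
Definition poisson (R : realType) (n : nat) (N : affine_manifold R n)
    (P : bivector N) : Prop :=
  forall c : chart R n N, atlas c -> forall a b d : N -> R,
    smooth_on c a -> smooth_on c b -> smooth_on c d ->
    forall x, dom c x -> Jac P c a b d x = 0.

Definition B2 (R : realType) (n : nat) (N : affine_manifold R n)
    (P : bivector N) (c : chart R n N) (f g : N -> R) : N -> R :=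
  let P := P c in let D := pd c in
  \sum_i \sum_j \sum_k \sum_l
   ((1 / 2) *: (P i j * P k l * D i (D k f) * D j (D l g))
  + (1 / 3) *: (P k l * D l (P i j) * D i (D k f) * D j g
              + P k l * D k (P i j) * D i f * D j (D l g))
  + (1 / 6) *: (D k (P i j) * D j (P k l) * D i f * D l g)).

Definition B3 (R : realType) (n : nat) (N : affine_manifold R n)
    (P : bivector N) (c : chart R n N) (f g : N -> R) : N -> R :=
  let P := P c in let D := pd c in
  \sum_i \sum_j \sum_k \sum_l \sum_p \sum_q
   ((1 / 6) *:
     (P i j * P k l * P p q * D i (D k (D p f)) * D j (D l (D q g))
    + P p q * D k (D p (P i j)) * D j (D q (P k l)) * D i f * D l g
    + P p q * D k (P i j) * D j (P k l) * D i (D p f) * D l (D q g)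
    + P p q * D p (P k l) * D q (D l (P i j)) * D i (D k f) * D j g
    + P p q * D p (D k (P i j)) * D q (P k l) * D i f * D j (D l g)
    + P k l * P p q * D l (D q (P i j)) * D i (D k (D p f)) * D j g
    + P k l * P p q * D k (D p (P i j)) * D i f * D j (D l (D q g)))
  + (1 / 3) *:
     (P p q * P k l * D l (P i j) * D i (D k (D p f)) * D j (D q g)
    + P p q * P k l * D k (P i j) * D i (D p f) * D j (D l (D q g)))
  + (1 / 6) *:
     (P p q * D k (P i j) * D q (D j (P k l)) * D i (D p f) * D l g
    + P p q * D p (D k (P i j)) * D j (P k l) * D i f * D l (D q g)
    + P p q * D q (P k l) * D k (P i j) * D i (D p f) * D j (D l g)
    + P p q * D p (P k l) * D l (P i j) * D i (D k f) * D j (D q g))).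

Definition B (R : realType) (n : nat) (N : affine_manifold R n)
    (P : bivector N) (c : chart R n N) (p : 'I_4) (f g : N -> R) : N -> R :=
  match val p with
  | 0%N => f * g
  | 1%N => bracket P c f g
  | 2%N => B2 P c f g
  | _ => B3 P c f g
  end.

(* [F : 'I_4 -> N -> R] stands for the series [\sum_(q < 4) F q * hbar^q]
   modulo [o(hbar^3)]. *)
Definition star (R : realType) (n : nat) (N : affine_manifold R n)
    (P : bivector N) (c : chart R n N) (F G : 'I_4 -> N -> R) :
    'I_4 -> N -> R :=
  fun m => \sum_(p < 4) \sum_(q < 4) \sum_(r < 4 | (p + q + r == m)%N)
    B P c p (F q) (G r).

Definition hconst (R : realType) (n : nat) (N : affine_manifold R n)
    (f : N -> R) : 'I_4 -> N -> R :=
  fun q => if q == ord0 then f else 0.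

Definition Assoc (R : realType) (n : nat) (N : affine_manifold R n)
    (P : bivector N) (c : chart R n N) (f g h : N -> R) : 'I_4 -> N -> R :=
  star P c (star P c (hconst f) (hconst g)) (hconst h)
  - star P c (hconst f) (star P c (hconst g) (hconst h)).

Definition triop (R : realType) (n : nat) (N : affine_manifold R n) : Type :=
  (N -> R) -> (N -> R) -> (N -> R) -> N -> R.

Definition op_eq (R : realType) (n : nat) (N : affine_manifold R n)
    (c : chart R n N) (X Y : triop N) : Prop :=
  forall f g h : N -> R, smooth_on c f -> smooth_on c g -> smooth_on c h ->
  forall x, dom c x -> X f g h x = Y f g h x.

Definition assoc3 (R : realType) (n : nat) (N : affine_manifold R n)
    (P : bivector N) (c : chart R n N) : triop N :=
  fun f g h => Assoc P c f g h ord_max.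

Definition S_f (R : realType) (n : nat) (N : affine_manifold R n)
    (P : bivector N) (c : chart R n N) : triop N :=
  fun f g h => \sum_i \sum_j P c i j * pd c j (Jac P c (pd c i f) g h).

Definition S_g (R : realType) (n : nat) (N : affine_manifold R n)
    (P : bivector N) (c : chart R n N) : triop N :=
  fun f g h => \sum_i \sum_j P c i j * pd c j (Jac P c f (pd c i g) h).

Definition S_h (R : realType) (n : nat) (N : affine_manifold R n)
    (P : bivector N) (c : chart R n N) : triop N :=
  fun f g h => \sum_i \sum_j P c i j * pd c j (Jac P c f g (pd c i h)).

Definition I_f (R : realType) (n : nat) (N : affine_manifold R n)
    (P : bivector N) (c : chart R n N) : triop N :=
  fun f g h => \sum_i \sum_j pd c j (Jac P c (P c i j) g h) * pd c i f.

Definition I_g (R : realType) (n : nat) (N : affine_manifold R n)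
    (P : bivector N) (c : chart R n N) : triop N :=
  fun f g h => \sum_i \sum_j pd c j (Jac P c f (P c i j) h) * pd c i g.

Definition I_h (R : realType) (n : nat) (N : affine_manifold R n)
    (P : bivector N) (c : chart R n N) : triop N :=
  fun f g h => \sum_i \sum_j pd c j (Jac P c f g (P c i j)) * pd c i h.

(* The tadpole terms of [I_f] and [I_h]: the part of the Leibniz expansion in
   which [pd c j] falls on [P c i j]. *)
Definition tadpole_f (R : realType) (n : nat) (N : affine_manifold R n)
    (P : bivector N) (c : chart R n N) : triop N :=
  fun f g h => \sum_i \sum_j Jac P c (pd c j (P c i j)) g h * pd c i f.

Definition tadpole_h (R : realType) (n : nat) (N : affine_manifold R n)
    (P : bivector N) (c : chart R n N) : triop N :=
  fun f g h => \sum_i \sum_j Jac P c f g (pd c j (P c i j)) * pd c i h.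

(* Multi-indices all of whose entries are at most [d]. *)
Definition multi (n d : nat) : finType := {ffun 'I_n -> 'I_d.+1}.

Definition mabs (n d : nat) (I : multi n d) : nat := (\sum_(i < n) I i)%N.

Definition mpd (R : realType) (n : nat) (N : affine_manifold R n)
    (c : chart R n N) (d : nat) (I : multi n d) (f : N -> R) : N -> R :=
  foldr (fun i => iter (I i) (pd c i)) f (enum 'I_n).

(* The family of coefficients [c^{IJK}] of a tri-differential operator. As the
   domain of a chart carries all polynomials in its coordinates, the operator
   determines these coefficients (on that domain). *)
Record symbol (R : realType) (n : nat) (N : affine_manifold R n) := Symbol {
  sdeg : nat;
  scoef : multi n sdeg -> multi n sdeg -> multi n sdeg -> N -> R }.

Definition op_of (R : realType) (n : nat) (N : affine_manifold R n)
    (c : chart R n N) (s : symbol N) : triop N :=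
  fun f g h => \sum_I \sum_J \sum_K
    scoef (s := s) I J K * mpd c I f * mpd c J g * mpd c K h.

Definition srestr (R : realType) (n : nat) (N : affine_manifold R n)
    (s : symbol N) (i j k : nat) : symbol N :=
  Symbol (fun I J K : multi n (sdeg s) =>
    if [&& mabs I == i, mabs J == j & mabs K == k] then scoef I J K else 0).

(* The restriction of the operator with symbol [s] to differential order
   [(i, j, k)]. *)
Definition restr (R : realType) (n : nat) (N : affine_manifold R n)
    (c : chart R n N) (s : symbol N) (i j k : nat) : triop N :=
  op_of c (srestr s i j k).

(* A graph over [m] sinks with internal vertices [m], [m + 1], ...: the [a]-th
   item is the pair of targets of the ordered edges (Left, Right) which issue
   from the internal vertex [m + a]. *)
Definition graph : Type := seq (nat * nat).
Definition gsum : Type := seq (rat * graph).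

Definition order3 (G : graph) : nat * nat * nat :=
  let t := [seq e.1 | e <- G] ++ [seq e.2 | e <- G] in
  (count_mem 0%N t, count_mem 1%N t, count_mem 2%N t).

(* Every internal vertex carries a copy of [P], every edge carries a summation
   index and acts on its target by the respective partial derivative. *)
Definition target (G : graph) (e : 'I_(size G) * bool) : nat :=
  let t := nth (0, 0)%N G e.1 in if e.2 then t.2 else t.1.

Definition incoming (n : nat) (G : graph)
    (idx : {ffun 'I_(size G) * bool -> 'I_n}) (v : nat) : seq 'I_n :=
  [seq idx e | e <- enum {: 'I_(size G) * bool} & target e == v].

Definition geval (R : realType) (n : nat) (N : affine_manifold R n)
    (P : bivector N) (c : chart R n N) (G : graph) (F : seq (N -> R)) :
    N -> R :=
  \sum_(idx : {ffun 'I_(size G) * bool -> 'I_n})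
    (\prod_(a < size G) pds c (incoming idx (size F + a))
                            (P c (idx (a, false)) (idx (a, true)))) *
    \prod_(s < size F) pds c (incoming idx s) (nth 0 F s).

Definition gsum_eval (R : realType) (n : nat) (N : affine_manifold R n)
    (P : bivector N) (c : chart R n N) (S : gsum) : triop N :=
  fun f g h => \sum_(x <- S) ratr x.1 *: geval P c x.2 [:: f; g; h].

(* The graphs (over the sinks f = 0, g = 1) of [B], in the same order of terms;
   the internal vertices 2, 3, 4 are the copies of [P] with the indices
   [ij], [kl], [pq], respectively. *)
Definition starG (p : nat) : gsum :=
  match p with
  | 0%N => [:: (1, [::])]
  | 1%N => [:: (1, [:: (0, 1)]%N)]
  | 2%N => [:: (1 / 2, [:: (0, 1); (0, 1)]%N);
               (1 / 3, [:: (0, 1); (0, 2)]%N);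
               (1 / 3, [:: (0, 1); (2, 1)]%N);
               (1 / 6, [:: (0, 3); (2, 1)]%N)]
  | 3%N => [:: (1 / 6, [:: (0, 1); (0, 1); (0, 1)]%N);
               (1 / 6, [:: (0, 3); (2, 1); (2, 3)]%N);
               (1 / 6, [:: (0, 3); (2, 1); (0, 1)]%N);
               (1 / 6, [:: (0, 1); (0, 2); (3, 2)]%N);
               (1 / 6, [:: (0, 1); (2, 1); (2, 3)]%N);
               (1 / 6, [:: (0, 1); (0, 2); (0, 2)]%N);
               (1 / 6, [:: (0, 1); (2, 1); (2, 1)]%N);
               (1 / 3, [:: (0, 1); (0, 2); (0, 1)]%N);
               (1 / 3, [:: (0, 1); (2, 1); (0, 1)]%N);
               (1 / 6, [:: (0, 3); (2, 1); (0, 3)]%N);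
               (1 / 6, [:: (0, 3); (2, 1); (2, 1)]%N);
               (1 / 6, [:: (0, 1); (2, 1); (0, 3)]%N);
               (1 / 6, [:: (0, 1); (0, 2); (3, 1)]%N)]
  | _ => [::]
  end.

Definition relabel (r : nat -> nat) (G : graph) : graph :=
  [seq (r e.1, r e.2) | e <- G].

(* All the graphs obtained by sending every edge of [G] with the target [t] to
   one of the vertices in [opts t]. *)
Fixpoint redirect (opts : nat -> seq nat) (G : graph) : seq graph :=
  if G is e :: G' then
    [seq ab :: H | ab <- [seq (a, b) | a <- opts e.1, b <- opts e.2],
                   H <- redirect opts G']
  else [:: [::]].

(* The terms of [X(Y(f, g), h)] and [X(f, Y(g, h))] by the Leibniz rule, over
   the sinks f = 0, g = 1, h = 2; the internal vertices of [X] precede those of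
   [Y], whose [a]-th one thus becomes [3 + size X + a]. *)
Definition insert_left (X Y : graph) : seq graph :=
  let y t := if (t < 2)%N then t else (3 + size X + (t - 2))%N in
  let x t := if t == 0%N then [seq y v | v <- iota 0 (2 + size Y)]
             else [:: t.+1] in
  [seq H ++ relabel y Y | H <- redirect x X].

Definition insert_right (X Y : graph) : seq graph :=
  let y t := if (t < 2)%N then t.+1 else (3 + size X + (t - 2))%N in
  let x t := if t == 1%N then [seq y v | v <- iota 0 (2 + size Y)]
             else if t == 0%N then [:: 0%N] else [:: t.+1] in
  [seq H ++ relabel y Y | H <- redirect x X].

Definition gcomp (ins : graph -> graph -> seq graph) (a : rat) (S T : gsum) :
    gsum :=
  flatten [seq [seq (a * x.1 * y.1, H) | H <- ins x.2 y.2] | x <- S, y <- T].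

(* The terms at [hbar^m] in the associator, before any are collected. *)
Definition assocG (m : nat) : gsum :=
  flatten [seq gcomp insert_left 1 (starG p) (starG (m - p)) ++
               gcomp insert_right (-1) (starG p) (starG (m - p))
          | p <- iota 0 m.+1].

(* [signed_copies m G]: the graphs [H], with signs, such that [G = H] (false)
   or [G = - H] (true) by renumbering the internal vertices and by using
   [P^{ij} = - P^{ji}] at some of them. *)
Fixpoint flips (G : graph) : seq (bool * graph) :=
  if G is e :: G' then
    [seq (~~ x.1, (e.2, e.1) :: x.2) | x <- flips G'] ++
    [seq (x.1, e :: x.2) | x <- flips G']
  else [:: (false, [::])].

Definition renumber (m : nat) (s : seq nat) (G : graph) : graph :=
  relabel (fun t => if (t < m)%N then t else (m + index (t - m)%N s)%N)
    [seq nth (0, 0)%N G a | a <- s].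

Definition signed_copies (m : nat) (G : graph) : seq (bool * graph) :=
  flatten [seq flips (renumber m s G) | s <- permutations (iota 0 (size G))].

Definition similar (m : nat) (G H : graph) : bool :=
  let s := signed_copies m G in ((false, H) \in s) || ((true, H) \in s).

(* The total coefficient of [G] in [S]; it is 0 if [G = - G]. *)
Definition gcoef (m : nat) (S : gsum) (G : graph) : rat :=
  foldr (fun x a => let s := signed_copies m x.2 in
    x.1 * (((false, G) \in s)%:R - ((true, G) \in s)%:R) + a) 0 S.

Fixpoint representatives (m : nat) (s : seq graph) : seq graph :=
  if s is G :: s' then
    let r := representatives m s' in if has (similar m G) r then r else G :: r
  else [::].

Definition collect (m : nat) (S : gsum) : gsum :=
  [seq x <- [seq (gcoef m S G, G) | G <- representatives m [seq x.2 | x <- S]]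
  | x.1 != 0].

Definition A_terms : gsum := collect 3 (assocG 3).

Definition A_terms_of (i j k : nat) : gsum :=
  [seq x <- A_terms | order3 x.2 == (i, j, k)].

(* Main.v *)
Require Import Defs.
From HB Require Import structures.
From mathcomp Require Import all_boot all_order all_algebra.
From mathcomp Require Import all_classical all_reals all_analysis.
From mathcomp Require Import zify ring perm.

Set Implicit Arguments.
Unset Strict Implicit.
Unset Printing Implicit Defensive.

Import Order.TTheory GRing.Theory Num.Theory.
Import numFieldNormedType.Exports.

Local Open Scope classical_set_scope.
Local Open Scope ring_scope.

(** The associator at third order is a polynomial in the components of P, in
    f, g, h and in their partial derivatives.  The equalities of the statement
    follow from four rules only: partial derivatives obey the Leibniz rule, they
    commute, P is skew-symmetric, and summation indices may be renamed.  The
    Jacobi identity enters only where the statement asks that something vanish.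

    The analytic content is that on the domain of a chart the smooth functions
    are closed under the ring operations and under the partial derivatives
    ([generated_smooth]), and that the partial derivatives commute there
    ([pd_swap], a symmetry-of-second-derivatives theorem, [derivative_swap]).

    The algebraic content is carried out on formal expressions with named bound
    indices.  An expression is expanded by linearity and the Leibniz rule into
    a list of terms, a coefficient times a sum over the bound indices of a
    product of derivatives ([normP]).  In a fully contracted term the six
    indices are the ends of the edges of a graph with three copies of P as
    internal vertices.  The term is unchanged by renumbering the vertices and
    changes its sign when the two edges of one vertex are swapped.  A canonical
    form is the least arrangement over all orders of the vertices, with the
    edges of each vertex ordered by their targets ([canonP]).  Collecting equal
    canonical forms establishes an equality of sums of terms ([agreeP]), and
    every equality of the statement becomes a finite computation.

    For the vanishing of all restrictions of S_f, ..., I_h separately, the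
    symbols are chosen in terms of the components J^{abd} of the Jacobiator:
    S_f = P^{ij} d_j (J^{abd} d_a d_i f d_b g d_d h) and similarly for the other
    five.  By the Leibniz rule every coefficient of these symbols contains a
    derivative of some J^{abd}, and for a Poisson bivector J^{abd} is zero on
    the whole chart, since it is the Jacobiator of three coordinate functions
    ([Jac_ucoord]).  Hence each coefficient vanishes, whatever the differential
    order ([poisson_symbol]).  The associator is the sum of its seven
    restrictions, each of which is a combination of restrictions of these
    operators and, at order (1, 1, 1), of the tadpole terms, which are values
    of the Jacobiator. *)

(** * Symmetry of second derivatives *)

Lemma line_is_derive (R : realType) (V : normedModType R) (F : V -> R)
    (y u : V) (s : R) :
  derivable F (y + s *: u) u ->
  is_derive s 1 (fun t : R => F (y + t *: u)) ('D_u F (y + s *: u)).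
Proof.
move=> dF; have E : (fun h : R => h^-1 *:
    (((fun t : R => F (y + t *: u)) \o shift s) (h *: 1)
       - F (y + s *: u))) =
  (fun h : R => h^-1 *: ((F \o shift (y + s *: u)) (h *: u)
       - F (y + s *: u))).
  apply/funext => h /=; congr (_ *: (F _ - _)).
  by rewrite -[h *: 1]/(h * 1) mulr1 scalerDl addrCA.
by split; rewrite /derivable /derive E.
Qed.

Lemma line_MVT (R : realType) (V : normedModType R) (F : V -> R) (y u : V)
    (h : R) : 0 < h ->
  (forall s, 0 <= s <= h -> derivable F (y + s *: u) u) ->
  exists2 s, 0 < s < h & F (y + h *: u) - F y = 'D_u F (y + s *: u) * h.
Proof.
move=> h0 dF.
have D s : 0 <= s <= h ->
    is_derive s 1 (fun t : R => F (y + t *: u)) ('D_u F (y + s *: u)).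
  by move=> ?; apply/line_is_derive/dF.
have [] := @MVT R (fun t => F (y + t *: u)) (fun s => 'D_u F (y + s *: u))
  0 h h0.
- by move=> s; rewrite in_itv /= => /andP[/ltW s0 /ltW sh]; apply/D/andP.
- apply: derivable_within_continuous => s; rewrite in_itv /= => sh.
  by have [] := D s sh.
by move=> s; rewrite in_itv /= scale0r addr0 subr0 => ? ?; exists s.
Qed.

(** The second difference of F over the parallelogram spanned by h u and h w
    equals, by two applications of the mean value theorem, h^2 times either
    mixed derivative at some point of the parallelogram.  Both mixed derivatives
    are continuous at v, so they agree there up to any error as h tends to 0. *)
Lemma derivative_swap (R : realType) (V : normedModType R) (F : V -> R)
    (u w v : V) (U : set V) :
  open U -> U v ->
  (forall y, U y -> derivable F y u) -> (forall y, U y -> derivable F y w) ->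
  (forall y, U y -> derivable ('D_u F) y w) ->
  (forall y, U y -> derivable ('D_w F) y u) ->
  {for v, continuous ('D_w ('D_u F))} -> {for v, continuous ('D_u ('D_w F))} ->
  'D_w ('D_u F) v = 'D_u ('D_w F) v.
Proof.
move=> oU Uv du dw duw dwu cuw cwu.
apply/eqP; rewrite -subr_eq0 -normr_le0; apply/ler_addgt0Pl => e e0.
rewrite addr0.
have e2 : 0 < e / 2 by rewrite divr_gt0.
pose A := 'D_w ('D_u F) v; pose B := 'D_u ('D_w F) v.
have nb : \forall y \near v,
  U y /\ (`|A - 'D_w ('D_u F) y| < e / 2 /\ `|B - 'D_u ('D_w F) y| < e / 2).
  have cA : 'D_w ('D_u F) @ v --> A by exact: cuw.
  have cB : 'D_u ('D_w F) @ v --> B by exact: cwu.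
  apply: filterI; first exact: open_nbhs_nbhs.
  apply: filterI; [move/cvgrPdist_lt: cA; exact|move/cvgrPdist_lt: cB; exact].
have /nbhs_ballP[r /= r0 Hr] := nb.
(* This [h] keeps the whole parallelogram in the ball of radius [r]. *)
pose h := r / (2 * (`|u| + `|w| + 1)).
have K0 : 0 < `|u| + `|w| + 1 by rewrite ltr_wpDl // addr_ge0.
have h0 : 0 < h by rewrite divr_gt0 // mulr_gt0.
have near_v s t : 0 <= s <= h -> 0 <= t <= h -> ball v r (v + s *: u + t *: w).
  move=> /andP[s0 sh] /andP[t0 th].
  rewrite -ball_normE /ball_ /= opprD addrA opprD addrA subrr sub0r -opprD normrN.
  apply: (le_lt_trans (ler_normD _ _)); rewrite !normrZ !ger0_norm //.
  apply: (@le_lt_trans _ _ (h * (`|u| + `|w| + 1))).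
    rewrite !mulrDr mulr1 ler_wpDr //; first exact: ltW.
    by apply: lerD; apply: ler_wpM2r.
  rewrite /h invfM mulrA mulfVK ?gt_eqF // ltr_pdivrMr //.
  by rewrite mulr_natr mulr2n ltrDl.
have near_v' s t : 0 <= s <= h -> 0 <= t <= h -> ball v r (v + t *: w + s *: u).
  by move=> ? ?; rewrite addrAC; exact: near_v.
have hh : 0 <= h <= h by rewrite lexx ltW.
have h00 : 0 <= (0 : R) <= h by rewrite lexx ltW.
have U1 s t sh th := (Hr _ (near_v s t sh th)).1.
have U2 s t sh th := (Hr _ (near_v' s t sh th)).1.
pose G y := F (y + h *: w) - F y; pose G' y := F (y + h *: u) - F y.
have E : G (v + h *: u) - G v = G' (v + h *: w) - G' v.
  rewrite /G /G' (addrAC v (h *: w)) !opprB; ring.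
have dG s : 0 <= s <= h -> derivable G (v + s *: u) u /\
    'D_u G (v + s *: u) =
    'D_u F (v + s *: u + h *: w) - 'D_u F (v + s *: u).
  move=> sh.
  have d1 : derivable F (v + s *: u) u.
    by apply: du; have := U1 s 0 sh h00; rewrite scale0r addr0.
  have d2 : derivable F (v + s *: u + h *: w) u by apply: du; exact: U1.
  have Ed : (fun k : R => k^-1 *:
      (((fun y => F (y + h *: w)) \o shift (v + s *: u)) (k *: u)
       - F (v + s *: u + h *: w))) =
     (fun k : R => k^-1 *: ((F \o shift (v + s *: u + h *: w)) (k *: u)
       - F (v + s *: u + h *: w))).
    by apply/funext => k /=; congr (_ *: (F _ - _)); rewrite -!addrA.
  have d3 : derivable (fun y => F (y + h *: w)) (v + s *: u) u.
    by rewrite /derivable Ed.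
  have d4 : 'D_u (fun y => F (y + h *: w)) (v + s *: u) =
      'D_u F (v + s *: u + h *: w) by rewrite /derive Ed.
  by split; [exact: derivableB|rewrite -d4; exact: deriveB].
have dG' t : 0 <= t <= h -> derivable G' (v + t *: w) w /\
    'D_w G' (v + t *: w) =
    'D_w F (v + t *: w + h *: u) - 'D_w F (v + t *: w).
  move=> th.
  have d1 : derivable F (v + t *: w) w.
    by apply: dw; have := U1 0 t h00 th; rewrite scale0r addr0.
  have d2 : derivable F (v + t *: w + h *: u) w by apply: dw; exact: U2.
  have Ed : (fun k : R => k^-1 *:
      (((fun y => F (y + h *: u)) \o shift (v + t *: w)) (k *: w)
       - F (v + t *: w + h *: u))) =
     (fun k : R => k^-1 *: ((F \o shift (v + t *: w + h *: u)) (k *: w)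
       - F (v + t *: w + h *: u))).
    by apply/funext => k /=; congr (_ *: (F _ - _)); rewrite -!addrA.
  have d3 : derivable (fun y => F (y + h *: u)) (v + t *: w) w.
    by rewrite /derivable Ed.
  have d4 : 'D_w (fun y => F (y + h *: u)) (v + t *: w) =
      'D_w F (v + t *: w + h *: u) by rewrite /derive Ed.
  by split; [exact: derivableB|rewrite -d4; exact: deriveB].
have [s s0h Es] := line_MVT h0 (fun s sh => (dG s sh).1).
have sh : 0 <= s <= h by case/andP: s0h => /ltW -> /ltW ->.
have [t t0h Et] := @line_MVT _ _ ('D_u F) (v + s *: u) w h h0
  (fun t th => duw _ (U1 s t sh th)).
have th : 0 <= t <= h by case/andP: t0h => /ltW -> /ltW ->.
have [t' t0h' Et'] := line_MVT h0 (fun t th => (dG' t th).1).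
have th' : 0 <= t' <= h by case/andP: t0h' => /ltW -> /ltW ->.
have [s' s0h' Es'] := @line_MVT _ _ ('D_w F) (v + t' *: w) u h h0
  (fun s sh => dwu _ (U2 s t' sh th')).
have sh' : 0 <= s' <= h by case/andP: s0h' => /ltW -> /ltW ->.
move: E; rewrite Es Et' (dG s sh).2 (dG' t' th').2 Et Es'.
have hn : h != 0 by rewrite gt_eqF.
move=> /(mulIf hn) /(mulIf hn) E.
have a1 := (Hr _ (near_v s t sh th)).2.1.
have a2 := (Hr _ (near_v' s' t' sh' th')).2.2.
apply: ltW; rewrite -[X in `|X| < _]/(A - B).
rewrite E in a1; move: a1 a2; set X := 'D_u _ _; clearbody A B X => a1 a2.
rewrite (_ : A - B = (A - X) + (X - B)); last by rewrite addrA subrK.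
apply: (le_lt_trans (ler_normD (A - X) (X - B))).
by have := ltrD a1 a2; rewrite -splitr (distrC B).
Qed.

(** * Smooth functions on the domain of a chart *)

Section Calculus.
Variables (R : realType) (n : nat) (N : affine_manifold R n).
Variable c : chart R n N.
Implicit Types (f g h : N -> R) (x : N).

Definition eq_on f g : Prop := forall x, dom c x -> f x = g x.
Local Notation "f =c g" := (eq_on f g) (at level 70).

Lemma eq_on_refl f : f =c f. Proof. by []. Qed.
Lemma eq_on_sym f g : f =c g -> g =c f.
Proof. by move=> E x /E. Qed.
Lemma eq_on_trans g f h : f =c g -> g =c h -> f =c h.
Proof. by move=> E1 E2 x dx; rewrite E1 // E2. Qed.
Lemma eq_onD f f' g g' : f =c f' -> g =c g' -> f + g =c f' + g'.
Proof. by move=> E1 E2 x dx; rewrite !fctE E1 // E2. Qed.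
Lemma eq_onM f f' g g' : f =c f' -> g =c g' -> f * g =c f' * g'.
Proof. by move=> E1 E2 x dx; rewrite !fctE E1 // E2. Qed.
Lemma eq_onN f f' : f =c f' -> - f =c - f'.
Proof. by move=> E x dx; rewrite !fctE E. Qed.
Lemma eq_onZ (a : R) f f' : f =c f' -> a *: f =c a *: f'.
Proof. by move=> E x dx; rewrite !fctE E. Qed.
Lemma eq_on_sum (I : Type) (r : seq I) (p : pred I) (F G : I -> N -> R) :
  (forall i, p i -> F i =c G i) ->
  \sum_(i <- r | p i) F i =c \sum_(i <- r | p i) G i.
Proof.
by move=> E; elim/big_ind2: _ => // *; apply: eq_onD.
Qed.
Lemma eq_onZ0 (a : R) f : f =c 0 -> a *: f =c 0.
Proof. by move=> E x dx; rewrite !fctE E // scaler0. Qed.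
Lemma eq_onM0 f g : f =c 0 -> f * g =c 0.
Proof. by move=> E x dx; rewrite !fctE E // mul0r. Qed.
Lemma eq_on_sum0 (I : Type) (r : seq I) (p : pred I) (F : I -> N -> R) :
  (forall i, p i -> F i =c 0) -> \sum_(i <- r | p i) F i =c 0.
Proof.
move=> E; elim/big_ind: _ => // f g Ef Eg.
by rewrite -(addr0 0); exact: eq_onD.
Qed.
Lemma eq_on_sum_seq (I : eqType) (r : seq I) (F G : I -> N -> R) :
  (forall i, i \in r -> F i =c G i) ->
  \sum_(i <- r) F i =c \sum_(i <- r) G i.
Proof.
by move=> E; rewrite big_seq [X in _ =c X]big_seq; exact: eq_on_sum.
Qed.
Lemma eq_on_prod (I : eqType) (r : seq I) (F G : I -> N -> R) :
  (forall i, i \in r -> F i =c G i) ->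
  \prod_(i <- r) F i =c \prod_(i <- r) G i.
Proof.
by move=> E; rewrite big_seq [X in _ =c X]big_seq;
  elim/big_ind2: _ => // *; apply: eq_onM.
Qed.

Local Notation lift f := (f \o icoord c).

Lemma near_dom (P : 'rV[R]_n -> Prop) x : dom c x ->
  (forall y, dom c y -> P (Defs.coord c y)) ->
  \forall v \near Defs.coord c x, P v.
Proof.
move=> dx HP.
have dU : nbhs (Defs.coord c x) (Defs.coord c @` dom c).
  by apply: open_nbhs_nbhs; split; [exact: Defs.coord_open|exists x].
by apply: filterS dU => _ [y dy <-]; exact: HP.
Qed.

Lemma near_chart f g x : f =c g -> dom c x ->
  \forall v \near Defs.coord c x, lift f v = lift g v.
Proof.
by move=> E dx; apply: near_dom => // y dy /=; rewrite Defs.coordK //; exact: E.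
Qed.

Lemma pd_eq_on i f g : f =c g -> pd c i f =c pd c i g.
Proof. by move=> E x dx; exact/near_eq_derive/near_chart. Qed.

Lemma pds_eq_on l f g : f =c g -> pds c l f =c pds c l g.
Proof. by move=> E; elim: l => //= i l IH; exact: pd_eq_on. Qed.

(** The two conditions which [smooth_on] imposes on every iterated derivative. *)
Definition regular f : Prop := forall x, dom c x -> {for x, continuous f} /\
  forall i, derivable (lift f) (Defs.coord c x) (delta_mx 0 i).

Lemma regular_eq_on f g : f =c g -> regular f -> regular g.
Proof.
move=> E rf x dx; have [cf df] := rf x dx; split.
  rewrite /prop_for /continuous_at -E //; apply: cvg_trans cf.
  apply: near_eq_cvg; have : nbhs x (dom c).
    by apply: open_nbhs_nbhs; split=> //; exact: dom_open.
  by apply: filterS => y /E.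
by move=> i; apply: near_eq_derivable (df i); exact: near_chart.
Qed.

(** A class of regular functions which is stable under the partial derivatives,
    up to equality on the domain, consists of smooth functions.  This avoids any
    formula for the higher derivatives of sums and products. *)
Lemma smooth_coind (C : (N -> R) -> Prop) :
  (forall f, C f -> regular f) ->
  (forall f i, C f -> exists2 g, C g & pd c i f =c g) ->
  forall f, C f -> smooth_on c f.
Proof.
move=> Cr Cd f Cf.
have H l : exists2 g, C g & pds c l f =c g.
  elim: l => [|i l [g Cg E]]; first by exists f.
  have [g' Cg' E'] := Cd g i Cg; exists g' => //.
  by apply: eq_on_trans E'; exact: pd_eq_on.
move=> l x dx; have [g /Cr rg /eq_on_sym E] := H l.
exact: (regular_eq_on E rg) dx.
Qed.

Lemma smooth_regular f : smooth_on c f -> regular f.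
Proof. by move=> sf x dx; exact: (sf [::] x dx). Qed.

Lemma pds_rcons l i f : pds c (rcons l i) f = pds c l (pd c i f).
Proof. by rewrite /pds foldr_rcons. Qed.

Lemma smooth_pd i f : smooth_on c f -> smooth_on c (pd c i f).
Proof. by move=> sf l x dx; have := sf (rcons l i) x dx; rewrite pds_rcons. Qed.

Lemma smooth_pds l f : smooth_on c f -> smooth_on c (pds c l f).
Proof. by move=> sf; elim: l => [|i l]; [exact: sf|exact: smooth_pd]. Qed.

Lemma regularD f g : regular f -> regular g -> regular (f + g).
Proof.
move=> rf rg x dx; have [cf df] := rf x dx; have [cg dg] := rg x dx; split.
  exact: continuousD.
by move=> i; exact: derivableD.
Qed.

Lemma regularM f g : regular f -> regular g -> regular (f * g).
Proof.
move=> rf rg x dx; have [cf df] := rf x dx; have [cg dg] := rg x dx; split.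
  exact: continuousM.
by move=> i; exact: derivableM.
Qed.

Lemma regular_cst (a : R) : regular (cst a).
Proof. by move=> x dx; split; [exact: cst_continuous|move=> i; exact: derivable_cst]. Qed.

Lemma pd_cst i (a : R) : pd c i (cst a) = 0.
Proof. by apply/funext => x; rewrite /pd derive_cst. Qed.

Lemma pdD i f g : regular f -> regular g ->
  pd c i (f + g) =c pd c i f + pd c i g.
Proof.
by move=> rf rg x dx; have [_ df] := rf x dx; have [_ dg] := rg x dx;
  rewrite /pd !fctE -deriveD.
Qed.

Lemma pdM i f g : regular f -> regular g ->
  pd c i (f * g) =c pd c i f * g + f * pd c i g.
Proof.
move=> rf rg x dx; have [_ df] := rf x dx; have [_ dg] := rg x dx.
rewrite /pd !fctE -[LHS]/('D_(delta_mx 0 i) (lift f * lift g) (Defs.coord c x)).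
rewrite (deriveM (df i) (dg i)) /= (Defs.coordK dx) addrC.
by congr (_ + _); exact: mulrC.
Qed.

Definition ucoord (i : 'I_n) : N -> R := fun x => Defs.coord c x 0 i.

Lemma ucoord_deriv i j x : dom c x ->
  is_derive (Defs.coord c x) (delta_mx 0 j) (lift (ucoord i)) (i == j)%:R.
Proof.
move=> dx; apply: (@near_eq_is_derive _ _ _ (fun v : 'rV[R]_n => v 0 i)).
- by apply: near_dom => // y dy /=; rewrite /ucoord Defs.coordK.
have E : (fun h : R => h^-1 *: (((fun v : 'rV[R]_n => v 0 i) \o shift (Defs.coord c x))
   (h *: delta_mx 0 j) - Defs.coord c x 0 i)) @ 0^' --> ((i == j)%:R : R).
  apply: (@cvg_trans _ ((fun=> (i == j)%:R : R) @ 0^')); last exact: cvg_cst.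
  apply: near_eq_cvg; near=> h.
  rewrite /= !mxE addrK eqxx /= /cst /GRing.scale /= mulrA mulVf ?mul1r //.
  by near: h; exact: nbhs_dnbhs_neq.
split; first by apply/cvg_ex; exists (i == j)%:R.
exact/cvg_lim.
Unshelve. all: by end_near.
Qed.

Lemma pd_ucoord i j : pd c j (ucoord i) =c cst (i == j)%:R.
Proof. by move=> x dx; rewrite /pd; have [_ ->] := ucoord_deriv i j dx. Qed.

Lemma regular_ucoord i : regular (ucoord i).
Proof.
move=> x dx; split; last by move=> j; have [] := ucoord_deriv i j dx.
have := @Defs.coord_continuous _ _ _ c x dx.
move=> H; apply: (@continuous_comp _ _ _ (Defs.coord c) (fun v : 'rV_n => v 0 i)) => //.
exact: coord_continuous.
Qed.

(** The smallest class to which [smooth_coind] is applied.  It is stable under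
    the partial derivatives because these obey the sum and product rules and
    send a coordinate function to a constant. *)
Inductive generated : (N -> R) -> Prop :=
| gen_smooth f : smooth_on c f -> generated f
| gen_cst (a : R) : generated (cst a)
| gen_coord i : generated (ucoord i)
| gen_add f g : generated f -> generated g -> generated (f + g)
| gen_mul f g : generated f -> generated g -> generated (f * g).

Lemma generated_regular f : generated f -> regular f.
Proof.
elim=> {f} [f|a|i|f g _ rf _ rg|f g _ rf _ rg].
- exact: smooth_regular.
- exact: regular_cst.
- exact: regular_ucoord.
- exact: regularD.
- exact: regularM.
Qed.

Lemma generated_smooth f : generated f -> smooth_on c f.
Proof.
apply: smooth_coind => {f} [|f i]; first exact: generated_regular.
elim=> {f} [f sf|a|j|f g Gf [f' Gf' Ef] Gg [g' Gg' Eg]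
           |f g Gf [f' Gf' Ef] Gg [g' Gg' Eg]].
- by exists (pd c i f) => //; exact/gen_smooth/smooth_pd.
- by exists (cst 0); [exact: gen_cst|rewrite pd_cst].
- by exists (cst (j == i)%:R); [exact: gen_cst|exact: pd_ucoord].
- exists (f' + g'); first exact: gen_add.
  by apply: eq_on_trans (pdD _ _ _) _ => //; try exact: generated_regular;
    exact: eq_onD.
- exists (f' * g + f * g'); first by apply: gen_add; exact: gen_mul.
  apply: eq_on_trans (pdM _ _ _) _; try exact: generated_regular.
  by apply: eq_onD; exact: eq_onM.
Qed.

Lemma smooth_cst a : smooth_on c (cst a).
Proof. exact/generated_smooth/gen_cst. Qed.

Lemma smooth_ucoord i : smooth_on c (ucoord i).
Proof. exact/generated_smooth/gen_coord. Qed.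

Lemma smoothD f g : smooth_on c f -> smooth_on c g -> smooth_on c (f + g).
Proof. by move=> /gen_smooth ? /gen_smooth ?; exact/generated_smooth/gen_add. Qed.

Lemma smoothM f g : smooth_on c f -> smooth_on c g -> smooth_on c (f * g).
Proof. by move=> /gen_smooth ? /gen_smooth ?; exact/generated_smooth/gen_mul. Qed.

Lemma scale_cst (a : R) f : a *: f = cst a * f.
Proof. by []. Qed.

Lemma smoothZ (a : R) f : smooth_on c f -> smooth_on c (a *: f).
Proof.
by move=> sf; rewrite scale_cst; exact: (smoothM (smooth_cst a) sf).
Qed.

Lemma smoothN f : smooth_on c f -> smooth_on c (- f).
Proof. by rewrite -scaleN1r; exact: smoothZ. Qed.

Lemma smooth_sum (I : Type) (r : seq I) (p : pred I) (F : I -> N -> R) :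
  (forall i, p i -> smooth_on c (F i)) -> smooth_on c (\sum_(i <- r | p i) F i).
Proof.
move=> sF; elim/big_ind: _ => [|f g|i].
- exact: (smooth_cst 0).
- exact: smoothD.
- exact: sF.
Qed.

Lemma smooth_prod (I : eqType) (r : seq I) (F : I -> N -> R) :
  (forall i, i \in r -> smooth_on c (F i)) -> smooth_on c (\prod_(i <- r) F i).
Proof.
move=> sF; rewrite big_seq; elim/big_ind: _ => [|f g|i].
- exact: (smooth_cst 1).
- exact: smoothM.
- exact: sF.
Qed.

Lemma pdZ i (a : R) f : smooth_on c f -> pd c i (a *: f) =c a *: pd c i f.
Proof.
move=> sf; rewrite !scale_cst.
have := @pdM i (cst a) f (@regular_cst a) (smooth_regular sf).
by rewrite pd_cst mul0r add0r.
Qed.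

Lemma pdN i f : smooth_on c f -> pd c i (- f) =c - pd c i f.
Proof. by move=> sf; rewrite -(scaleN1r f) -(scaleN1r (pd c i f)); exact: pdZ. Qed.

Lemma pds_opp l f : smooth_on c f -> pds c l (- f) =c - pds c l f.
Proof.
move=> sf; elim: l => [|i l IH]; first exact: eq_on_refl.
by apply: eq_on_trans (pd_eq_on _ IH) _; exact: (pdN _ (smooth_pds _ sf)).
Qed.

Lemma pd_sum (I : Type) i (r : seq I) (p : pred I) (F : I -> N -> R) :
  (forall j, p j -> smooth_on c (F j)) ->
  pd c i (\sum_(j <- r | p j) F j) =c \sum_(j <- r | p j) pd c i (F j).
Proof.
move=> sF; elim: r => [|j r IH]; first by rewrite !big_nil (pd_cst i 0).
rewrite !big_cons; case: ifP => // pj.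
have r1 := smooth_regular (sF j pj); have r2 := smooth_regular (smooth_sum r sF).
by apply: eq_on_trans (pdD i r1 r2) _; apply: eq_onD IH.
Qed.

(** [derivative_swap] in the coordinates of the chart; a derivative taken on the
    manifold agrees with the one taken in coordinates only near the image of
    the domain, which is open. *)
Lemma pd_swap i j f : smooth_on c f -> pd c i (pd c j f) =c pd c j (pd c i f).
Proof.
move=> sf x dx.
pose U := Defs.coord c @` dom c; pose F := lift f.
have liftE k g v : U v -> lift (pd c k g) v = 'D_(delta_mx 0 k) (lift g) v.
  by move=> [y dy <-] /=; rewrite /pd /= Defs.coordK.
have nearU v : U v -> \forall y \near v, U y.
  by move=> Uv; apply: open_nbhs_nbhs; split => //; exact: coord_open.
have d2 k l y : U y -> derivable ('D_(delta_mx 0 k) F) y (delta_mx 0 l).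
  move=> Uy; apply: (@near_eq_derivable _ _ _ (lift (pd c k f))).
      by apply: filterS (nearU _ Uy) => v Uv; exact: liftE.
  case: Uy => z dz <-.
  exact: ((smooth_regular (smooth_pd k sf) dz).2 l).
have E k l v : U v -> lift (pd c k (pd c l f)) v =
    'D_(delta_mx 0 k) ('D_(delta_mx 0 l) F) v.
  move=> Uv; rewrite (liftE _ _ _ Uv); apply: near_eq_derive.
  by apply: filterS (nearU _ Uv) => y Uy; exact: liftE.
have Ux : U (Defs.coord c x) by exists x.
have cont k l : {for Defs.coord c x,
    continuous ('D_(delta_mx 0 k) ('D_(delta_mx 0 l) F))}.
  have cE : {for Defs.coord c x, continuous (lift (pd c k (pd c l f)))}.
    apply: (@continuous_comp _ _ _ (icoord c)).
      exact: (icoord_continuous Ux).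
    rewrite (Defs.coordK dx).
    exact: (smooth_regular (smooth_pd k (smooth_pd l sf)) dx).1.
  rewrite /prop_for /continuous_at -(E k l _ Ux).
  apply: (cvg_trans _ cE); apply: near_eq_cvg.
    exact: (nbhs_filter (Defs.coord c x)).
  by apply: filterS (nearU _ Ux) => v Uv; exact: E.
have d1 k y : U y -> derivable F y (delta_mx 0 k).
  by move=> [z dz <-]; exact: ((smooth_regular sf dz).2 k).
have := @derivative_swap R _ F (delta_mx 0 j) (delta_mx 0 i) (Defs.coord c x) U
  (@coord_open _ _ _ c) Ux (d1 j) (d1 i) (d2 j i) (d2 i j) (cont i j) (cont j i).
by rewrite -(E i j _ Ux) -(E j i _ Ux) /= (Defs.coordK dx).
Qed.

Lemma pds_cat l l' f : pds c (l ++ l') f = pds c l (pds c l' f).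
Proof. by rewrite /pds foldr_cat. Qed.

Lemma pd_pds i l f : smooth_on c f -> pd c i (pds c l f) =c pds c l (pd c i f).
Proof.
move=> sf; elim: l => [|j l IH]; first exact: eq_on_refl.
apply: eq_on_trans (pd_swap _ _ (smooth_pds _ sf)) _.
exact: (pd_eq_on _ IH).
Qed.

Lemma pds_perm l l' f : smooth_on c f -> perm_eq l l' -> pds c l f =c pds c l' f.
Proof.
move=> sf; elim: l l' => [|i l IH] l'.
  by rewrite perm_sym => /perm_nilP ->.
move=> p; have il' : i \in l' by rewrite -(perm_mem p) mem_head.
case/splitPr: il' p => l1 l2; rewrite perm_sym -cat1s perm_catCA perm_cons.
rewrite perm_sym => p; rewrite pds_cat /=.
apply: eq_on_trans (pd_eq_on _ (IH _ p)) _; rewrite pds_cat.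
exact/pd_pds/smooth_pds.
Qed.

End Calculus.
(** * Formal expressions and their expansion *)

(** The names of the summation indices: the Left ([false]) and Right ([true])
    index of each of three copies of P, as for the edges of a graph. *)
Definition label : finType := ('I_3 * bool)%type.
Definition v0 : 'I_3 := @Ordinal 3 0 isT.
Definition v1 : 'I_3 := @Ordinal 3 1 isT.
Definition v2 : 'I_3 := @Ordinal 3 2 isT.
Definition labels : seq label :=
  [:: (v0, false); (v0, true); (v1, false); (v1, true); (v2, false); (v2, true)].
Definition code (l : label) : nat := (2 * l.1 + l.2)%N.

(** A symbol with its own indices, followed by the indices of the derivatives
    which act on it.  Symbols 0, 1, 2 are the arguments f, g, h (without
    indices), 3 is P with two indices and 4 is the component of the Jacobiator
    with three indices. *)
Definition factor : eqType := ((nat * seq label) * seq label)%type.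
Definition monomial : eqType := seq factor.
(** A coefficient, the list of bound indices and a product. *)
Definition term : eqType := (rat * seq label * monomial)%type.

(** [Inv k x] stands for [x / k] and [Sum l x] for the sum of [x] over the
    index [l]; the other constructors name the operations on functions. *)
Inductive exp :=
| Atom of nat & seq label
| Add of exp & exp
| Opp of exp
| Mul of exp & exp
| Der of label & exp
| Inv of nat & exp
| Sum of label & exp.

Definition scale_term (q : rat) (t : term) : term := (q * t.1.1, t.1.2, t.2).
Definition scale_terms q := map (scale_term q).

Fixpoint leibniz (l : label) (m : monomial) : seq monomial :=
  if m is f :: m' then ((f.1, l :: f.2) :: m') :: [seq f :: x | x <- leibniz l m']
  else [::].

Definition monomial_labels (m : monomial) : seq label :=
  flatten [seq f.1.2 ++ f.2 | f : factor <- m].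

Definition mul_term (t u : term) : term :=
  (t.1.1 * u.1.1, t.1.2 ++ u.1.2, t.2 ++ u.2).
Definition der_term (l : label) (t : term) : seq term :=
  [seq (t.1, m) | m <- leibniz l t.2].

Fixpoint norm (x : exp) : seq term :=
  match x with
  | Atom k ls => [:: (1, [::], [:: ((k, ls), [::])])]
  | Add x y => norm x ++ norm y
  | Opp x => scale_terms (-1) (norm x)
  | Mul x y => [seq mul_term t u | t <- norm x, u <- norm y]
  | Der l x => flatten [seq der_term l t | t <- norm x]
  | Inv k x => scale_terms (1 / k%:R) (norm x)
  | Sum l x => [seq (t.1.1, l :: t.1.2, t.2) | t : term <- norm x]
  end.

Definition apart (s t : seq label) : bool := ~~ has (mem s) t.
Definition mul_ok (t u : term) : bool :=
  [&& apart t.1.2 u.1.2, apart t.1.2 (monomial_labels u.2) & apart u.1.2 (monomial_labels t.2)].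

(** The expansion concatenates the bound indices of the factors of a product and
    moves derivatives inside sums.  This is correct if no index is captured. *)
Fixpoint no_capture (x : exp) : bool :=
  match x with
  | Atom _ _ => true
  | Add x y => no_capture x && no_capture y
  | Opp x | Inv _ x => no_capture x
  | Mul x y => [&& no_capture x, no_capture y &
                allrel mul_ok (norm x) (norm y)]
  | Der l x | Sum l x => no_capture x && all (fun t : term => l \notin t.1.2) (norm x)
  end.

(** * Canonical forms *)

(** The renaming which turns the frame [s], that is, the indices of the copies of
    P read in some order, into the standard list of indices. *)
Definition rename (s : seq label) (l : label) : label := nth l labels (index l s).
Definition rename_mon (r : label -> label) (m : monomial) : monomial :=
  [seq ((f.1.1, map r f.1.2), map r f.2) | f : factor <- m].

(** Skew-symmetry is used to put the indices of P in increasing order. *)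
Definition flip_of (f : factor) : bool * factor :=
  if f.1 is (3, [:: a; b]) then
    if (code b < code a)%N then (true, ((3, [:: b; a]), f.2)) else (false, f)
  else (false, f).

Fixpoint lexle (s t : seq nat) : bool :=
  match s, t with
  | [::], _ => true
  | _, [::] => false
  | a :: s', b :: t' => (a < b)%N || (a == b) && lexle s' t'
  end.

Definition head_key (f : factor) : seq nat := f.1.1 :: map code f.1.2.
Definition key (m : monomial) : seq nat :=
  flatten [seq head_key f | f <- m] ++
  flatten [seq size f.2 :: map code f.2 | f : factor <- m].

Definition sort_ders (f : factor) : factor := (f.1, sort (relpre code leq) f.2).
Definition sort_mon (m : monomial) : monomial :=
  sort (relpre head_key lexle) (map sort_ders m).
Fixpoint flip_mon (m : monomial) : bool * monomial :=
  if m is f :: m' then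
    let x := flip_of f in let y := flip_mon m' in (x.1 (+) y.1, x.2 :: y.2)
  else (false, [::]).
Definition arrange (m : monomial) : bool * monomial :=
  let x := flip_mon m in (x.1, sort_mon x.2).

Definition place (p : seq (seq label)) (f : factor) : nat :=
  if f.1.1 == 3 then (3 + index f.1.2 p)%N else f.1.1.
Definition target_place (m : monomial) (p : seq (seq label)) (l : label) : nat :=
  head 0%N [seq place p f | f : factor <- m & l \in f.2].

(** Renumbering the vertices and swapping the edges at each of them would give
    6 * 8 variants of a graph.  Once the order of the vertices is fixed, the edges
    at a vertex are ordered by the places of their targets instead; both orders
    are kept only if the targets coincide.  In that case the two variants
    differ by their signs alone. *)
Definition orientations (m : monomial) (p : seq (seq label)) (x : seq label) :=
  if x is [:: a; b] then
    if (target_place m p a < target_place m p b)%N then [:: x]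
    else if (target_place m p b < target_place m p a)%N then [:: [:: b; a]]
    else [:: x; [:: b; a]]
  else [:: x].

(** The test on renaming ensures its injectivity, whatever the monomial. *)
Definition frames (m : monomial) : seq (seq label) :=
  [seq s <- flatten [seq foldr (fun x r => [seq y ++ z | y <- orientations m p x, z <- r])
                              [:: [::]] p |
                    p <- permutations [seq f.1.2 | f : factor <- m & f.1.1 == 3]]
  | uniq (map (rename s) labels)].

Definition variants (m : monomial) : seq (bool * monomial) :=
  [seq arrange (rename_mon (rename s) m) | s <- frames m].

Definition best (s : seq (bool * monomial)) x0 :=
  foldr (fun x y => if lexle (key x.2) (key y.2) then x else y) x0 s.

(** A monomial with the same arrangement under both signs is its own opposite,
    hence the coefficient 0.  The default [(1, m)] concerns monomials without
    frames, whose copies of P do not carry all six indices. *)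
Definition canon (m : monomial) : rat * monomial :=
  if variants m is v :: s then
    let x := best s v in
    (if (~~ x.1, x.2) \in v :: s then 0 else (-1) ^+ x.1, x.2)
  else (1, m).

Fixpoint insert_term (q : rat) (m : monomial) (s : seq (rat * monomial)) :=
  if s is x :: s' then
    if x.2 == m then (q + x.1, m) :: s' else x :: insert_term q m s'
  else [:: (q, m)].

Definition merge_terms (T : seq term) : seq (rat * monomial) :=
  foldr (fun (t : term) s => let x := canon t.2 in insert_term (t.1.1 * x.1) x.2 s)
    [::] T.

Definition closed_term (t : term) : bool := perm_eq t.1.2 labels.
Definition cancels (T : seq term) : bool :=
  all closed_term T && all (fun x => x.1 == 0) (merge_terms T).

Definition agree (T U : seq term) : bool := cancels (T ++ scale_terms (-1) U).

(** * Values of expressions *)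

Section Semantics.
Variables (R : realType) (n : nat) (N : affine_manifold R n).
Variable c : chart R n N.
Variable V : nat -> seq 'I_n -> N -> R.
Hypothesis V_smooth : forall k ls, smooth_on c (V k ls).
Local Notation "f =c g" := (eq_on c f g) (at level 70).
Local Notation env := (label -> 'I_n).
Implicit Types (e : env) (b : seq label) (m : monomial) (x y : exp).

Definition rebind e (l : label) (i : 'I_n) : env :=
  fun l' => if l' == l then i else e l'.

Fixpoint denote e x : N -> R :=
  match x with
  | Atom k ls => V k (map e ls)
  | Add x y => denote e x + denote e y
  | Opp x => - denote e x
  | Mul x y => denote e x * denote e y
  | Der l x => pd c (e l) (denote e x)
  | Inv k x => (1 / k%:R) *: denote e x
  | Sum l x => \sum_i denote (rebind e l i) x
  end.

Definition factor_val e (f : factor) : N -> R :=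
  pds c (map e f.2) (V f.1.1 (map e f.1.2)).
Definition monomial_val e m : N -> R := \prod_(f <- m) factor_val e f.
(** The sum over the values of the indices in [b]; all other indices keep the
    values given by [e]. *)
Definition index_sum b e (K : env -> N -> R) : N -> R :=
  \sum_(d : {ffun label -> 'I_n} | [forall l, (l \in b) || (d l == e l)]) K d.
Definition term_val e (t : term) : N -> R := ratr t.1.1 *: index_sum t.1.2 e (monomial_val^~ t.2).
Definition terms_val e (T : seq term) : N -> R := \sum_(t <- T) term_val e t.

Lemma smooth_factor_val e f : smooth_on c (factor_val e f).
Proof. exact: (smooth_pds _ (V_smooth _ _)). Qed.

Lemma smooth_monomial_val e m : smooth_on c (monomial_val e m).
Proof. by apply: smooth_prod => f _; exact: smooth_factor_val. Qed.

Lemma smooth_index_sum b e (K : env -> N -> R) :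
  (forall d, smooth_on c (K d)) -> smooth_on c (index_sum b e K).
Proof. by move=> sK; apply: smooth_sum => d _; exact: sK. Qed.

Lemma smooth_term_val e t : smooth_on c (term_val e t).
Proof. by apply/smoothZ/smooth_index_sum => d; exact: smooth_monomial_val. Qed.

Lemma terms_val_cat e T U : terms_val e (T ++ U) = terms_val e T + terms_val e U.
Proof. by rewrite /terms_val big_cat. Qed.

Lemma term_val_scale e q t : term_val e (scale_term q t) = ratr q *: term_val e t.
Proof. by rewrite /term_val rmorphM scalerA. Qed.

Lemma terms_val_scale e q T : terms_val e (scale_terms q T) = ratr q *: terms_val e T.
Proof.
by rewrite /terms_val big_map scaler_sumr; apply: eq_bigr => t _; exact: term_val_scale.
Qed.

Lemma index_sum_eq_on b e (K K' : env -> N -> R) :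
  (forall d, (forall l, l \notin b -> d l = e l) -> K d =c K' d) ->
  index_sum b e K =c index_sum b e K'.
Proof.
move=> E; apply: eq_on_sum => d /forallP H; apply: E => l lb.
by apply/eqP; have := H l; rewrite (negPf lb).
Qed.

Lemma index_sum0 e K : index_sum [::] e K = K e.
Proof.
rewrite /index_sum (big_pred1 (finfun e)).
  by congr K; apply/funext => l; rewrite ffunE.
move=> d /=; apply/forallP/eqP => [H|-> l].
  by apply/ffunP => l; rewrite ffunE; have /= /eqP := H l.
by rewrite ffunE eqxx.
Qed.

Lemma index_sum_cons l b e K : l \notin b ->
  \sum_i index_sum b (rebind e l i) K = index_sum (l :: b) e K.
Proof.
move=> lb;
  rewrite {2}/index_sum (partition_big (fun d : {ffun label -> 'I_n} => d l) xpredT) //=.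
apply: eq_bigr => i _; apply: eq_bigl => d; apply/forallP/andP => [H|[/forallP H /eqP <-] l'].
  split; last by have := H l; rewrite (negPf lb) /rebind eqxx.
  apply/forallP => l'; have := H l'; rewrite inE /rebind.
  by case: (eqVneq l' l) => [->|_] //=.
have := H l'; rewrite inE /rebind; case: (eqVneq l' l) => [->|_] //=.
by rewrite eqxx orbT.
Qed.

Lemma factor_val_ext e e' f : (forall l, l \in f.1.2 ++ f.2 -> e l = e' l) ->
  factor_val e f = factor_val e' f.
Proof.
move=> E; rewrite /factor_val; congr (pds c _ (V _ _)); apply/eq_in_map => l lf;
  by apply: E; rewrite mem_cat lf ?orbT.
Qed.

Lemma monomial_val_ext e e' m : (forall l, l \in monomial_labels m -> e l = e' l) ->
  monomial_val e m = monomial_val e' m.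
Proof.
rewrite /monomial_val; elim: m => [|f m IH] E; first by rewrite !big_nil.
have E' l : l \in f.1.2 ++ f.2 \/ l \in monomial_labels m -> e l = e' l.
  by move=> /orP H; apply: E; rewrite /monomial_labels /= mem_cat.
rewrite !big_cons (factor_val_ext (e' := e')) ?IH // => l H; apply: E'; by [left|right].
Qed.

Lemma apartP b (s : seq label) : reflect (forall l, l \in s -> l \notin b) (apart b s).
Proof. by apply: (iffP hasPn). Qed.

(** The induction binds an index of [b1] on the right factor too, which does not
    depend on it; the transposition of two values of this index then identifies
    the two ways to fix it. *)
Lemma index_sum_mul b1 b2 e m1 m2 :
  uniq b1 -> apart b1 b2 -> apart b1 (monomial_labels m2) -> apart b2 (monomial_labels m1) ->
  index_sum b1 e (monomial_val^~ m1) * index_sum b2 e (monomial_val^~ m2) =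
  index_sum (b1 ++ b2) e (monomial_val^~ (m1 ++ m2)).
Proof.
elim: b1 e => [|l b1 IH] e /=.
  move=> _ _ _ /apartP A; rewrite index_sum0 /index_sum mulr_sumr.
  apply: eq_bigr => d /forallP H; rewrite /monomial_val big_cat; congr (_ * _).
  apply: monomial_val_ext => l /A lb; apply/esym/eqP.
  by have := H l; rewrite (negPf lb).
move=> /andP[lb1 u1] /apartP A12 /apartP A2 A1.
have lb2 : l \notin b2.
  by apply/negP => /A12; rewrite mem_head.
rewrite -index_sum_cons // -index_sum_cons; last by rewrite mem_cat negb_or lb1.
rewrite mulr_suml; apply: eq_bigr => i _; rewrite -IH //.
- congr (_ * _); rewrite /index_sum.
  transitivity (index_sum b2 e (fun d => monomial_val (rebind d l i) m2)).
    apply: eq_bigr => d _; apply: monomial_val_ext => l' /A2;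
      rewrite inE negb_or => /andP[ll' _].
    by rewrite /rebind (negPf ll').
  rewrite /index_sum.
  pose h (d : {ffun label -> 'I_n}) :=
    [ffun l' => if l' == l then tperm i (e l) (d l) else d l'].
  rewrite (reindex_inj (h := h)) /=; last first.
    move=> d d' /ffunP E; apply/ffunP => l'; have := E l'; rewrite !ffunE.
    by case: (l' =P l) => [->|] // /perm_inj.
  apply: eq_big => [d|d _].
    apply: eq_forallb => l'; rewrite ffunE /rebind; case: (l' =P l) => [->|//].
    by rewrite (canF_eq (tpermK i (e l))) tpermR.
  apply: monomial_val_ext => l' /A2; rewrite inE negb_or => /andP[ll' _].
  by rewrite /rebind (negPf ll') ffunE (negPf ll').
- by apply/apartP => l' /A12; rewrite inE negb_or => /andP[].
- by apply/apartP => l' /A2; rewrite inE negb_or => /andP[].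
Qed.
Lemma scale_mul (a b : R) (f g : N -> R) : (a *: f) * (b *: g) = (a * b) *: (f * g).
Proof. by rewrite !scale_cst mulrACA. Qed.

Lemma pd_monomial_val l e m :
  pd c (e l) (monomial_val e m) =c \sum_(m' <- leibniz l m) monomial_val e m'.
Proof.
rewrite /monomial_val; elim: m => [|f m IH] /=.
  by rewrite !big_nil (pd_cst c (e l) 1); exact: eq_on_refl.
rewrite !big_cons big_map.
have rf := smooth_regular (smooth_factor_val e f).
have rm := smooth_regular (smooth_monomial_val e m).
apply: eq_on_trans (pdM (e l) rf rm) _.
apply: eq_onD; first exact: eq_on_refl.
under eq_bigr do rewrite big_cons.
by rewrite -mulr_sumr; apply: eq_onM IH; exact: eq_on_refl.
Qed.

Lemma pd_term_val l e t : l \notin t.1.2 ->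
  pd c (e l) (term_val e t) =c terms_val e (der_term l t).
Proof.
case: t => [[q b] m] /= lb.
have sI : smooth_on c (index_sum b e (monomial_val^~ m)).
  by apply: smooth_index_sum => d; exact: smooth_monomial_val.
apply: eq_on_trans (pdZ (e l) (ratr q) sI) _.
rewrite /terms_val /der_term big_map /term_val /= -scaler_sumr; apply: eq_onZ.
rewrite /index_sum exchange_big /=.
apply: eq_on_trans (pd_sum _ _ _) _; first by move=> d _; exact: smooth_monomial_val.
apply: eq_on_sum => d /forallP H.
have := H l; rewrite (negPf lb) => /eqP <-; exact: pd_monomial_val.
Qed.

Lemma bound_uniq x : no_capture x -> all (fun t : term => uniq t.1.2) (norm x).
Proof.
elim: x => //= [x IHx y IHy|x IH|x IHx y IHy|l x IH|k x IH|l x IH].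
- by move=> /andP[/IHx Hx /IHy Hy]; rewrite all_cat Hx.
- by move=> /IH H; rewrite all_map; exact: H.
- move=> /and3P[/IHx /allP Hx /IHy /allP Hy /allrelP A].
  apply/allP => _ /allpairsP[[t u] /= [tx uy ->]] /=.
  have /and3P[/hasPn A' _ _] := A _ _ tx uy.
  rewrite cat_uniq (Hx _ tx) (Hy _ uy) andbT /=.
  by apply/hasPn => l /A'.
- move=> /andP[/IH /allP H _]; apply/allP => t /flatten_mapP[u ux].
  by move=> /mapP[m _ ->]; exact: (H u ux).
- by move=> /IH H; rewrite all_map; exact: H.
- move=> /andP[/IH /allP H /allP H']; apply/allP => _ /mapP[t tx ->] /=.
  by rewrite H' // H.
Qed.

(** The rules of the expansion are the distributive law, the Leibniz rule and
    the interchange of a finite sum with a derivative. *)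
Lemma normP x e : no_capture x -> denote e x =c terms_val e (norm x).
Proof.
elim: x e => /= [k ls|x IHx y IHy|x IH|x IHx y IHy|l x IH|k x IH|l x IH] e.
- move=> _;
  rewrite /terms_val big_seq1 /term_val /= rmorph1 scale1r index_sum0 /monomial_val big_seq1.
  exact: eq_on_refl.
- by move=> /andP[/IHx Hx /IHy Hy]; rewrite terms_val_cat; exact: eq_onD.
- by move=> /IH H; rewrite terms_val_scale rmorphN1 scaleN1r; exact: eq_onN.
- move=> /and3P[nx ny /allrelP A].
  apply: eq_on_trans (eq_onM (IHx e nx) (IHy e ny)) _.
  rewrite /terms_val big_allpairs_dep mulr_suml.
  apply: eq_on_sum_seq => t tx.
  rewrite mulr_sumr; apply: eq_on_sum_seq => u uy.
  have /and3P[A1 A2 A3] := A _ _ tx uy.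
  rewrite /term_val scale_mul /= rmorphM index_sum_mul //.
  exact: (allP (bound_uniq nx)).
- move=> /andP[nx /allP lx].
  apply: eq_on_trans (pd_eq_on _ (IH e nx)) _.
  apply: eq_on_trans (pd_sum _ _ _) _; first by move=> t _; exact: smooth_term_val.
  rewrite /terms_val big_flatten big_map.
  by apply: eq_on_sum_seq => t /lx lt; exact: pd_term_val.
- move=> /IH H; rewrite terms_val_scale.
  have -> : ratr (1 / k%:R) = 1 / k%:R :> R.
    by rewrite rmorphM fmorphV rmorph1 rmorph_nat.
  exact: eq_onZ.
- move=> /andP[nx /allP lx].
  apply: (@eq_on_trans _ _ _ _ (\sum_i terms_val (rebind e l i) (norm x))).
    by apply: eq_on_sum => i _; exact: IH.
  rewrite /terms_val big_map exchange_big /=.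
  apply: eq_on_sum_seq => t /lx lt; rewrite /term_val /= -scaler_sumr index_sum_cons //.
Qed.

Lemma mem_labels l : l \in labels.
Proof.
by case: l => [[[|[|[|k]]] p] []].
Qed.

Lemma closed_index_sum b e K : perm_eq b labels ->
  index_sum b e K = \sum_(d : {ffun label -> 'I_n}) K d.
Proof.
move=> bl; apply: eq_bigl => d; apply/forallP => l.
by rewrite (perm_mem bl) mem_labels.
Qed.

(** The value of a fully contracted monomial. *)
Definition contraction m : N -> R := \sum_(d : {ffun label -> 'I_n}) monomial_val d m.

Lemma closed_terms_val e T : all closed_term T ->
  terms_val e T = \sum_(t <- T) ratr t.1.1 *: contraction t.2.
Proof.
move=> /allP H; rewrite /terms_val big_seq [RHS]big_seq.
by apply: eq_bigr => t /H ct; rewrite /term_val closed_index_sum.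
Qed.

Hypothesis V_skew : forall i j : 'I_n, V 3 [:: i; j] =c - V 3 [:: j; i].

Definition signed (s : bool) : R := (-1) ^+ s.

Lemma flip_ofP f e : factor_val e f =c signed (flip_of f).1 *: factor_val e (flip_of f).2.
Proof.
have E : factor_val e f =c signed false *: factor_val e f.
  by rewrite /signed expr0 scale1r; exact: eq_on_refl.
case: f E => [[k ls] ds] E; rewrite /flip_of.
case: k E => [|[|[|[|k]]]] //; case: ls => [|a [|b [|? ?]]] //= E.
case: ifP => // _; rewrite /signed expr1 scaleN1r /factor_val /=.
apply: eq_on_trans (pds_eq_on _ (V_skew (e a) (e b))) _.
exact: (pds_opp _ (V_smooth _ _)).
Qed.

Lemma flip_monP m e : monomial_val e m =c signed (flip_mon m).1 *: monomial_val e (flip_mon m).2.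
Proof.
elim: m => [|f m IH] /=.
  by rewrite /signed expr0 scale1r; exact: eq_on_refl.
rewrite /monomial_val !big_cons.
apply: eq_on_trans (eq_onM (flip_ofP f e) IH) _.
rewrite scale_mul /signed signr_addb.
exact: eq_on_refl.
Qed.

Lemma sort_monP m e : monomial_val e m =c monomial_val e (sort_mon m).
Proof.
have /permPl E := perm_sort (relpre head_key lexle) (map sort_ders m).
rewrite /monomial_val (perm_big _ E) big_map; apply: eq_on_prod => f _.
by apply: pds_perm => //; rewrite perm_sym; apply: perm_map; rewrite perm_sort.
Qed.

Lemma arrangeP m e : monomial_val e m =c signed (arrange m).1 *: monomial_val e (arrange m).2.
Proof.
apply: eq_on_trans (flip_monP m e) _; apply: eq_onZ; exact: sort_monP.
Qed.

(** An injective renaming of the indices permutes their assignments. *)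
Lemma contraction_rename (r : label -> label) m : injective r ->
  contraction (rename_mon r m) = contraction m.
Proof.
move=> ir; rewrite [RHS]/contraction.
pose h (d : {ffun label -> 'I_n}) := [ffun l => d (r l)].
rewrite (reindex_inj (h := h)) /=.
  apply: eq_bigr => d _; rewrite /monomial_val big_map; apply: eq_bigr => f _.
  rewrite /factor_val /= -!map_comp.
  by congr (pds c _ (V _ _)); apply: eq_map => l /=; rewrite ffunE.
move=> d d' /ffunP E; apply/ffunP => l.
have := E (invF ir l); by rewrite !ffunE f_invF.
Qed.

Lemma contraction_arrange m :
  contraction m =c signed (arrange m).1 *: contraction (arrange m).2.
Proof.
by rewrite /contraction scaler_sumr; apply: eq_on_sum => d _; exact: arrangeP.
Qed.

Lemma frame_inj m s : s \in frames m -> injective (rename s).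
Proof.
rewrite mem_filter => /andP[u _]; apply/injectiveP.
rewrite /injectiveb /dinjectiveb.
rewrite (perm_uniq (_ : perm_eq _ (map (rename s) labels))) //.
apply: perm_map; apply: uniq_perm; rewrite ?enum_uniq //.
by move=> l; rewrite mem_enum mem_labels.
Qed.

Lemma variantsP m v : v \in variants m -> contraction m =c signed v.1 *: contraction v.2.
Proof.
move=> /mapP[s sm ->]; rewrite -(contraction_rename m (frame_inj sm));
  exact: contraction_arrange.
Qed.

Lemma best_in s (v : bool * monomial) : best s v \in v :: s.
Proof.
elim: s => [|y s IH] /=; first by rewrite mem_head.
move: IH; rewrite !inE; case: ifP => _; first by rewrite eqxx orbT.
by move=> /orP[->|->]; rewrite ?orbT.
Qed.

(** Every variant has the value of the monomial up to the recorded sign.  If an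
    arrangement occurs with both signs, its value is opposite to itself. *)
Lemma canonP m : contraction m =c ratr (canon m).1 *: contraction (canon m).2.
Proof.
rewrite /canon; case Ev: (variants m) => [|v s] /=.
  by rewrite rmorph1 scale1r; exact: eq_on_refl.
have : best s v \in variants m by rewrite Ev; exact: best_in.
rewrite -Ev; set x := best s v => Hx.
have Ex := variantsP Hx; case: ifP => [Hy|_] /=; last first.
  by rewrite rmorphXn rmorphN1; exact: Ex.
have Ey := variantsP Hy; move=> y dy; have := Ex y dy; have := Ey y dy.
rewrite rmorph0 scale0r !fctE /= /signed => ->.
case: (x.1); rewrite /= ?expr0 ?expr1 ?scaleN1r ?scale1r => /eqP.
  by rewrite -addr_eq0 -mulr2n mulrn_eq0 /= => /eqP.
by rewrite eq_sym -addr_eq0 -mulr2n mulrn_eq0 /= => /eqP ->; rewrite oppr0.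
Qed.

Lemma insert_termP q m s :
  \sum_(x <- insert_term q m s) ratr x.1 *: contraction x.2 =
  (ratr q : R) *: contraction m + \sum_(x <- s) ratr x.1 *: contraction x.2.
Proof.
elim: s => [|[p m'] s IH] /=; first by rewrite big_seq1 big_nil addr0.
case: eqP => [/= ->|_]; rewrite !big_cons /=; first by rewrite rmorphD scalerDl addrA.
by rewrite IH addrCA.
Qed.

Lemma merge_termsP T :
  \sum_(t <- T) (ratr t.1.1 : R) *: contraction t.2 =c
  \sum_(x <- merge_terms T) ratr x.1 *: contraction x.2.
Proof.
elim: T => [|t T IH]; first by rewrite /= !big_nil.
rewrite -[merge_terms _]/(insert_term (t.1.1 * (canon t.2).1) (canon t.2).2
  (merge_terms T)) insert_termP big_cons.
have -> : ratr (t.1.1 * (canon t.2).1) = ratr t.1.1 * ratr (canon t.2).1 :> R.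
  exact: rmorphM.
by rewrite -(scalerA (ratr t.1.1) (ratr (canon t.2).1)); apply: eq_onD IH; apply: eq_onZ;
  exact: canonP.
Qed.

Lemma cancelsP e T : cancels T -> terms_val e T =c 0.
Proof.
move=> /andP[cT /allP z]; rewrite (closed_terms_val e cT).
apply: eq_on_trans (merge_termsP T) _; rewrite big_seq big1 //.
by move=> x /z /eqP ->; rewrite rmorph0 scale0r.
Qed.

Lemma agreeP e T U : agree T U -> terms_val e T =c terms_val e U.
Proof.
move=> /cancelsP - /(_ e); rewrite terms_val_cat terms_val_scale rmorphN1 scaleN1r.
by move=> E x dx; have := E x dx; rewrite !fctE /= => /subr0_eq.
Qed.

End Semantics.
(** * The operators as expressions *)

Local Notation li := ((v0, false) : label).
Local Notation lj := ((v0, true) : label).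
Local Notation lk := ((v1, false) : label).
Local Notation ll := ((v1, true) : label).
Local Notation lp := ((v2, false) : label).
Local Notation lq := ((v2, true) : label).

Definition Arg (s : nat) : exp := Atom s [::].
Definition P_atom (a b : label) : exp := Atom 3 [:: a; b].
Definition J_atom (a b d : label) : exp := Atom 4 [:: a; b; d].

Definition bracket_exp (v : 'I_3) (x y : exp) : exp :=
  let i := (v, false) in let j := (v, true) in
  Sum i (Sum j (Mul (Mul (P_atom i j) (Der i x)) (Der j y))).
Definition Jac_exp (u v : 'I_3) (x y z : exp) : exp :=
  Add (Add (bracket_exp u (bracket_exp v x y) z) (Opp (bracket_exp u (bracket_exp v x z) y)))
      (Opp (bracket_exp u x (bracket_exp v y z))).

Definition mul_all (x : exp) (s : seq exp) : exp := foldl Mul x s.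
Definition add_all (x : exp) (s : seq exp) : exp := foldl Add x s.

Definition B2_exp (u v : 'I_3) (x y : exp) : exp :=
  let i := (u, false) in let j := (u, true) in
  let k := (v, false) in let l := (v, true) in
  Sum i (Sum j (Sum k (Sum l
   (add_all
    (Inv 2 (mul_all (P_atom i j) [:: P_atom k l; Der i (Der k x); Der j (Der l y)]))
    [:: Inv 3 (Add (mul_all (P_atom k l) [:: Der l (P_atom i j); Der i (Der k x); Der j y])
                   (mul_all (P_atom k l) [:: Der k (P_atom i j); Der i x; Der j (Der l y)]));
     Inv 6 (mul_all (Der k (P_atom i j)) [:: Der j (P_atom k l); Der i x; Der l y])])))).

Definition B3_exp (x y : exp) : exp :=
  let i := li in let j := lj in let k := lk in let l := ll in
  let p := lp in let q := lq in let P := P_atom in let D := Der in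
  Sum i (Sum j (Sum k (Sum l (Sum p (Sum q
   (add_all (Inv 6 (add_all
     (mul_all (P i j) [:: P k l; P p q; D i (D k (D p x)); D j (D l (D q y))])
     [:: mul_all (P p q) [:: D k (D p (P i j)); D j (D q (P k l)); D i x; D l y];
      mul_all (P p q) [:: D k (P i j); D j (P k l); D i (D p x); D l (D q y)];
      mul_all (P p q) [:: D p (P k l); D q (D l (P i j)); D i (D k x); D j y];
      mul_all (P p q) [:: D p (D k (P i j)); D q (P k l); D i x; D j (D l y)];
      mul_all (P k l) [:: P p q; D l (D q (P i j)); D i (D k (D p x)); D j y];
      mul_all (P k l) [:: P p q; D k (D p (P i j)); D i x; D j (D l (D q y))]]))
    [:: Inv 3 (Add
      (mul_all (P p q) [:: P k l; D l (P i j); D i (D k (D p x)); D j (D q y)])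
      (mul_all (P p q) [:: P k l; D k (P i j); D i (D p x); D j (D l (D q y))]));
     Inv 6 (add_all
      (mul_all (P p q) [:: D k (P i j); D q (D j (P k l)); D i (D p x); D l y])
      [:: mul_all (P p q) [:: D p (D k (P i j)); D j (P k l); D i x; D l (D q y)];
       mul_all (P p q) [:: D q (P k l); D k (P i j); D i (D p x); D j (D l y)];
       mul_all (P p q) [:: D p (P k l); D l (P i j); D i (D k x); D j (D q y)]])])))))).

Definition assoc3_exp : exp :=
  let f := Arg 0 in let g := Arg 1 in let h := Arg 2 in
  Add
    (add_all (Mul (B3_exp f g) h)
      [:: bracket_exp v0 (B2_exp v1 v2 f g) h; B2_exp v0 v1 (bracket_exp v2 f g) h;
          B3_exp (Mul f g) h])
    (Opp (add_all (Mul f (B3_exp g h))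
      [:: bracket_exp v0 f (B2_exp v1 v2 g h); B2_exp v0 v1 f (bracket_exp v2 g h);
          B3_exp f (Mul g h)])).

Definition S_exp (x y z : exp) : exp :=
  Sum li (Sum lj (Mul (P_atom li lj) (Der lj (Jac_exp v1 v2 x y z)))).
Definition I_exp (x y z w : exp) : exp :=
  Sum li (Sum lj (Mul (Der lj (Jac_exp v1 v2 x y z)) (Der li w))).
Definition tadpole_exp (x y z w : exp) : exp :=
  Sum li (Sum lj (Mul (Jac_exp v1 v2 x y z) (Der li w))).

Definition S_f_exp := S_exp (Der li (Arg 0)) (Arg 1) (Arg 2).
Definition S_g_exp := S_exp (Arg 0) (Der li (Arg 1)) (Arg 2).
Definition S_h_exp := S_exp (Arg 0) (Arg 1) (Der li (Arg 2)).
Definition I_f_exp := I_exp (P_atom li lj) (Arg 1) (Arg 2) (Arg 0).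
Definition I_g_exp := I_exp (Arg 0) (P_atom li lj) (Arg 2) (Arg 1).
Definition I_h_exp := I_exp (Arg 0) (Arg 1) (P_atom li lj) (Arg 2).
Definition tadpole_f_exp := tadpole_exp (Der lj (P_atom li lj)) (Arg 1) (Arg 2) (Arg 0).
Definition tadpole_h_exp := tadpole_exp (Arg 0) (Arg 1) (Der lj (P_atom li lj)) (Arg 2).

(** The Jacobiator J^{abd} d_a x d_b y d_d z, as a trivector applied to three
    functions. *)
Definition Jac_components_exp (x y z : exp) : exp :=
  mul_all (J_atom lk ll lp) [:: Der lk x; Der ll y; Der lp z].
Definition sums (b : seq label) (x : exp) : exp := foldr Sum x b.
Definition SJ_exp (x y z : exp) : exp :=
  sums [:: li; lj; lk; ll; lp] (Mul (P_atom li lj) (Der lj (Jac_components_exp x y z))).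
Definition IJ_exp (x y z w : exp) : exp :=
  sums [:: li; lj; lk; ll; lp] (Mul (Der lj (Jac_components_exp x y z)) (Der li w)).

(** The terms of the symbols chosen for S_f, ..., I_h. *)
Definition S_f_terms := norm (SJ_exp (Der li (Arg 0)) (Arg 1) (Arg 2)).
Definition S_g_terms := norm (SJ_exp (Arg 0) (Der li (Arg 1)) (Arg 2)).
Definition S_h_terms := norm (SJ_exp (Arg 0) (Arg 1) (Der li (Arg 2))).
Definition I_f_terms := norm (IJ_exp (P_atom li lj) (Arg 1) (Arg 2) (Arg 0)).
Definition I_g_terms := norm (IJ_exp (Arg 0) (P_atom li lj) (Arg 2) (Arg 1)).
Definition I_h_terms := norm (IJ_exp (Arg 0) (Arg 1) (P_atom li lj) (Arg 2)).

(** Replaces J^{abd} by its definition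
    P^{kd} d_k P^{ab} - P^{kb} d_k P^{ad} - P^{ak} d_k P^{bd}.  The index [lq] is
    reserved for k, as only five of the six indices occur in the terms with a
    component of the Jacobiator. *)
Definition unfold_factor (f : factor) : exp :=
  foldr Der (if f.1 is (4, [:: a; b; d]) then
    Sum lq (Add (Add (Mul (P_atom lq d) (Der lq (P_atom a b)))
                     (Opp (Mul (P_atom lq b) (Der lq (P_atom a d)))))
                (Opp (Mul (P_atom a lq) (Der lq (P_atom b d)))))
    else Atom f.1.1 f.1.2) f.2.

Fixpoint unfold_mon (f : factor) (m : monomial) : exp :=
  if m is g :: m' then Mul (unfold_factor f) (unfold_mon g m')
  else unfold_factor f.

(** [Arg 0] is a default value: [unfoldable] excludes empty monomials. *)
Definition unfold_exp (t : term) : exp :=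
  if t.2 is f :: m then sums t.1.2 (unfold_mon f m) else Arg 0.

Definition unfold_terms (T : seq term) : seq term :=
  flatten [seq scale_terms t.1.1 (norm (unfold_exp t)) | t : term <- T].

Definition unfoldable (t : term) : bool :=
  [&& t.2 != [::], uniq t.1.2, no_capture (unfold_exp t) &
      all (fun f : factor => (f.1.1 == 4) ==> (lq \notin f.1.2)) t.2].

Definition sink_ders (s : nat) (m : monomial) : seq label :=
  flatten [seq f.2 | f : factor <- m & f.1.1 == s].
Definition orders (m : monomial) : nat * nat * nat :=
  (size (sink_ders 0 m), size (sink_ders 1 m), size (sink_ders 2 m)).
Definition part (i j k : nat) (T : seq term) : seq term :=
  [seq t <- T | orders t.2 == (i, j, k)].

Definition graph_target (G : graph) (l : label) : nat :=
  let t := nth (0, 0)%N G l.1 in if l.2 then t.2 else t.1.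
Definition graph_incoming (G : graph) (v : nat) : seq label :=
  [seq l <- labels | graph_target G l == v].
Definition graph_mon (G : graph) : monomial :=
  [seq ((3, [:: (a, false); (a, true)]), graph_incoming G (3 + a)) | a : 'I_3 <- [:: v0;
    v1; v2]]
  ++ [seq ((s, [::]), graph_incoming G s) | s <- [:: 0; 1; 2]%N].
Definition graph_terms (S : gsum) : seq term :=
  [seq (x.1, labels, graph_mon x.2) | x : rat * graph <- S].

Definition coef_part (m : monomial) : monomial :=
  [seq f : factor <- m | (2 < f.1.1)%N].
(** Each of f, g, h occurs exactly once.  The bound 6 on the number of
    derivatives is the number of indices. *)
Definition splits (m : monomial) : bool :=
  perm_eq m ([:: ((0%N, [::]), sink_ders 0 m); ((1%N, [::]), sink_ders 1 m);
                 ((2%N, [::]), sink_ders 2 m)] ++ coef_part m)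
  && all (fun s => size (sink_ders s m) <= 6)%N [:: 0; 1; 2]%N.
Definition is_J_factor (f : factor) : bool :=
  if f.1 is (4, [:: _; _; _]) then true else false.
(** * Terms as operators, graphs and symbols *)

Section Operators.
Variables (R : realType) (n : nat) (N : affine_manifold R n).
Variables (P : bivector N) (c : chart R n N).
Hypothesis hc : atlas c.
Local Notation "f =c g" := (eq_on c f g) (at level 70).
Local Notation env := (label -> 'I_n).

(** The Jacobiator of the coordinate functions u^a, u^b, u^d. *)
Definition jacobiator (a b d : 'I_n) : N -> R :=
  \sum_k (P c k d * pd c k (P c a b) - P c k b * pd c k (P c a d)
          - P c a k * pd c k (P c b d)).

Definition valuation (F : seq (N -> R)) (k : nat) (ls : seq 'I_n) : N -> R :=
  match k with
  | 3 => if ls is [:: i; j] then P c i j else 0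
  | 4 => if ls is [:: a; b; d] then jacobiator a b d else 0
  | _ => nth 0 F k
  end.

Lemma P_smooth i j : smooth_on c (P c i j).
Proof. exact: bcomp_smooth. Qed.

Lemma zero_smooth : smooth_on c 0.
Proof. rewrite (_ : 0 = cst (0 : R)); [exact: smooth_cst|by []]. Qed.

Lemma jacobiator_smooth a b d : smooth_on c (jacobiator a b d).
Proof.
apply: smooth_sum => k _.
have PdP i j i' j' : smooth_on c (P c i j * pd c k (P c i' j')).
  exact: (smoothM (P_smooth _ _) (smooth_pd _ (P_smooth _ _))).
exact: (smoothD (smoothD (PdP _ _ _ _) (smoothN (PdP _ _ _ _)))
  (smoothN (PdP _ _ _ _))).
Qed.

Section Valuation.
Variable F : seq (N -> R).
Hypothesis F_smooth : forall k, smooth_on c (nth 0 F k).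

Lemma valuation_smooth k ls : smooth_on c (valuation F k ls).
Proof.
case: k => [|[|[|[|[|k]]]]].
- exact: (F_smooth 0).
- exact: (F_smooth 1).
- exact: (F_smooth 2).
- case: ls => [|i [|j [|? ?]]];
    [exact: zero_smooth|exact: zero_smooth|exact: P_smooth|exact: zero_smooth].
- case: ls => [|a [|b [|d [|? ?]]]]; [exact: zero_smooth|exact: zero_smooth|
    exact: zero_smooth|exact: jacobiator_smooth|exact: zero_smooth].
- exact: (F_smooth k.+4.+1).
Qed.

Lemma valuation_skew i j :
  valuation F 3 [:: i; j] =c - valuation F 3 [:: j; i].
Proof. by move=> x dx; rewrite !fctE; exact: bcomp_skew. Qed.

Local Notation V := (valuation F).

Lemma denote_unfold_factor (e : env) f :
  (f.1.1 == 4) ==> (lq \notin f.1.2) ->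
  denote c V e (unfold_factor f) = factor_val c V e f.
Proof.
case: f => [[k ls] ds] /= H; rewrite /unfold_factor /factor_val /=.
elim: ds => [|l ds /= -> //] /=.
case: k H => [|[|[|[|[|k]]]]] //=.
case: ls => [|a [|b [|d [|? ?]]]] //=; rewrite !inE !negb_or.
move=> /and3P[qa qb qd]; apply: eq_bigr => k _.
have E l : lq != l -> rebind e lq k l = e l.
  by rewrite eq_sym /rebind => /negPf ->.
by rewrite (E _ qa) (E _ qb) (E _ qd) {1 3 5}/rebind eqxx.
Qed.

Lemma denote_unfold_mon (e : env) f m :
  all (fun f : factor => (f.1.1 == 4) ==> (lq \notin f.1.2)) (f :: m) ->
  denote c V e (unfold_mon f m) = monomial_val c V e (f :: m).
Proof.
elim: m f => [|g m IH] f.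
  by rewrite /monomial_val big_seq1 => /andP[Hf _]; exact: denote_unfold_factor.
move=> /andP[Hf Hm]; rewrite /monomial_val big_cons.
by rewrite -[denote _ _ _ _]/(denote c V e (unfold_factor f) *
  denote c V e (unfold_mon g m)) denote_unfold_factor // IH.
Qed.

Lemma denote_sums (e : env) b x : uniq b ->
  denote c V e (sums b x) = index_sum b e (fun d => denote c V d x).
Proof.
elim: b e => [|l b IH] e /=; first by rewrite index_sum0.
move=> /andP[lb ub]; rewrite -index_sum_cons //.
by apply: eq_bigr => i _; exact: IH.
Qed.

(** The bound index of the unfolded Jacobiator does not occur in the term, so the
    unfolded term has the same value and its expansion is correct. *)
Lemma unfold_termsP (e : env) T : all unfoldable T ->
  terms_val c V e T =c terms_val c V e (unfold_terms T).
Proof.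
move=> /allP H; rewrite /terms_val big_flatten big_map.
apply: eq_on_sum_seq => t /H /and4P[m0 ub nc jok].
have E := @normP _ _ _ c V valuation_smooth _ e nc.
rewrite -[X in _ =c X]/(terms_val c V e (scale_terms _ _)) terms_val_scale.
move: E m0 jok nc; rewrite /unfold_exp /term_val.
case: (t.2) => // f m E _ jok nc; apply: eq_onZ; apply: eq_on_sym.
apply: eq_on_trans (eq_on_sym E) _; rewrite denote_sums //.
by apply: index_sum_eq_on => d _; rewrite denote_unfold_mon.
Qed.

(** Both sides sum over the assignments of indices to the edges; only the order
    of the derivatives at a vertex differs. *)
Lemma geval_term G : size G = 3 -> size F = 3 ->
  geval P c G F =c contraction c V (graph_mon G).
Proof.
case: G => [//|e0 [//|e1 [//|e2 [|//]]]] _ sF.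
set G := [:: e0; e1; e2]; rewrite /geval /contraction.
apply: eq_on_sum => idx _.
have inc f v : smooth_on c f ->
    pds c (incoming idx v) f =c pds c (map idx (graph_incoming G v)) f.
  move=> sf; apply: pds_perm => //; apply: perm_map.
  rewrite /graph_incoming; apply: perm_filter.
  apply: uniq_perm; rewrite ?enum_uniq // => l.
  by rewrite mem_enum mem_labels.
rewrite /monomial_val /graph_mon big_cat sF; apply: eq_onM.
  rewrite big_map !big_ord_recl big_ord0 !big_cons big_nil.
  have -> : ord0 = v0 :> 'I_3 by apply/val_inj.
  have -> : lift v0 ord0 = v1 :> 'I_3 by apply/val_inj.
  have -> : lift v0 (lift ord0 ord0) = v2 :> 'I_3 by apply/val_inj.
  by do 3![apply: eq_onM; first exact: (inc _ _ (P_smooth _ _))].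
rewrite big_map !big_ord_recl big_ord0 !big_cons big_nil.
by do 3![apply: eq_onM; first exact: (inc _ _ (F_smooth _))].
Qed.

End Valuation.

Section ThreeArguments.
Variables f g h : N -> R.
Hypotheses (sf : smooth_on c f) (sg : smooth_on c g) (sh : smooth_on c h).
Local Notation F := [:: f; g; h].

Lemma arguments_smooth k : smooth_on c (nth 0 F k).
Proof.
case: k => [|[|[|k]]]; [exact: sf|exact: sg|exact: sh|].
by rewrite /= nth_nil; exact: zero_smooth.
Qed.

Definition three_sized (S : gsum) := all (fun x : rat * graph => size x.2 == 3) S.

Lemma gsum_eval_terms (e : env) S : three_sized S ->
  gsum_eval P c S f g h =c terms_val c (valuation F) e (graph_terms S).
Proof.
move=> /allP H; rewrite closed_terms_val; last by apply/allP => _ /mapP[x _ ->].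
rewrite /gsum_eval big_map; apply: eq_on_sum_seq => x /H /eqP sx; apply: eq_onZ.
exact: (geval_term arguments_smooth sx).
Qed.

(** The multi-index of an iterated derivative, for at most 6 derivatives. *)
Definition mindex (l : seq 'I_n) : multi n 6 :=
  [ffun i => inord (count_mem i l)].

Lemma count_flatten_mem (l : seq 'I_n) :
  perm_eq (flatten [seq nseq (count_mem i l) i | i <- enum 'I_n]) l.
Proof.
apply/allP => i _ /=; apply/eqP; rewrite count_flatten -map_comp sumnE big_map.
rewrite big_enum (bigD1 i) //= count_nseq /= eqxx mul1n big1 ?addn0 // => j ji.
by rewrite count_nseq /= (negPf ji).
Qed.

Lemma mindexE (l : seq 'I_n) i : (size l <= 6)%N -> mindex l i = count_mem i l :> nat.
Proof.
by move=> sl; rewrite ffunE inordK // ltnS; exact: leq_trans (count_size _ _) sl.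
Qed.

Lemma mpd_mindex (l : seq 'I_n) k : smooth_on c k -> (size l <= 6)%N ->
  mpd c (mindex l) k =c pds c l k.
Proof.
move=> sk sl; apply: eq_on_sym; apply: (@eq_on_trans _ _ _ _
    (pds c (flatten [seq nseq (count_mem i l) i | i <- enum 'I_n]) k)).
  by apply: (pds_perm sk); rewrite perm_sym; exact: count_flatten_mem.
rewrite (_ : pds _ _ _ = mpd c (mindex l) k); first exact: eq_on_refl.
rewrite /mpd; elim: (enum 'I_n) => [//|i s IH] /=.
rewrite pds_cat IH mindexE //; elim: (count_mem i l) => [//|m IHm] /=.
by rewrite IHm.
Qed.

Lemma mabs_mindex (l : seq 'I_n) : (size l <= 6)%N -> mabs (mindex l) = size l.
Proof.
move=> sl; rewrite -(perm_size (count_flatten_mem l)) size_flatten sumnE big_map.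
rewrite big_map big_enum; apply: eq_bigr => i _.
by rewrite size_nseq mindexE.
Qed.

(** The coefficient at (I, J, K) collects the assignments of the indices for which
    the derivatives of f, g, h are those of the multi-indices I, J, K. *)
Definition symbol_coef (e : env) (T : seq term) (I J K : multi n 6) : N -> R :=
  \sum_(t <- T) ratr t.1.1 *: index_sum t.1.2 e (fun d =>
    if (I, J, K) == (mindex (map d (sink_ders 0 t.2)),
      mindex (map d (sink_ders 1 t.2)), mindex (map d (sink_ders 2 t.2)))
    then monomial_val c (valuation [::]) d (coef_part t.2) else 0).

Definition symbol_of (e : env) (T : seq term) : symbol N :=
  Symbol (symbol_coef e T).

Lemma monomial_val_split (d : env) m : splits m ->
  monomial_val c (valuation F) d m =c
  monomial_val c (valuation [::]) d (coef_part m) *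
  (pds c (map d (sink_ders 0 m)) f * pds c (map d (sink_ders 1 m)) g *
   pds c (map d (sink_ders 2 m)) h).
Proof.
move=> /andP[pm _]; rewrite {1}/monomial_val (perm_big _ pm) big_cat /= mulrC.
rewrite !big_cons big_nil mulr1 mulrA; apply: eq_onM; last exact: eq_on_refl.
rewrite /monomial_val; apply: eq_on_prod => u; rewrite mem_filter => /andP[u3 _].
rewrite (_ : factor_val _ _ _ _ = factor_val c (valuation [::]) d u); first exact: eq_on_refl.
by case: u u3 => [[[|[|[|[|[|k]]]]] ls] ds].
Qed.

Lemma scale_mull (a : R) (u v : N -> R) : (a *: u) * v = a *: (u * v).
Proof. by rewrite !scale_cst mulrA. Qed.

(** A term contributes only to the multi-indices of its own derivatives, whose
    absolute values are the numbers of these derivatives; so a condition on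
    the differential order selects terms. *)
Lemma symbol_coefP (p : nat -> nat -> nat -> bool) (e : env) T :
  all (fun t : term => splits t.2) T ->
  \sum_I \sum_J \sum_K
    (if p (mabs I) (mabs J) (mabs K) then symbol_coef e T I J K else 0) *
    mpd c I f * mpd c J g * mpd c K h =c
  terms_val c (valuation F) e [seq t : term <- T |
    p (size (sink_ders 0 t.2)) (size (sink_ders 1 t.2)) (size (sink_ders 2 t.2))].
Proof.
move=> /allP sT; pose M := multi n 6.
pose W (q : M * M * M) := mpd c q.1.1 f * mpd c q.1.2 g * mpd c q.2 h.
pose p' (q : M * M * M) := p (mabs q.1.1) (mabs q.1.2) (mabs q.2).
pose q0 (t : term) (d : env) := (mindex (map d (sink_ders 0 t.2)),
  mindex (map d (sink_ders 1 t.2)), mindex (map d (sink_ders 2 t.2))).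
pose C (t : term) d := monomial_val c (valuation [::]) d (coef_part t.2).
rewrite pair_bigA /= pair_bigA /=.
rewrite (eq_bigr (fun q : M * M * M => \sum_(t <- T) ratr t.1.1 *:
   index_sum t.1.2 e (fun d => (if p' q && (q == q0 t d) then C t d else 0) * W q)));
     last first.
  move=> [[I J] K] _ /=; rewrite -!mulrA [mpd c I f * _]mulrA.
  rewrite -[mpd c I f * _ * _]/(W (I, J, K)) -[p _ _ _]/(p' (I, J, K)).
  case: (p' _); last first.
    rewrite mul0r big1 // => t _.
    by rewrite /index_sum big1 ?scaler0 // => d _; rewrite mul0r.
  rewrite /symbol_coef mulr_suml; apply: eq_bigr => t _.
  by rewrite scale_mull /index_sum mulr_suml.
rewrite exchange_big /=.
rewrite (_ : terms_val _ _ _ _ = \sum_(t <- T) if p (size (sink_ders 0 t.2))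
    (size (sink_ders 1 t.2)) (size (sink_ders 2 t.2))
  then term_val c (valuation F) e t else 0); last by rewrite /terms_val big_filter big_mkcond.
apply: eq_on_sum_seq => t /sT st.
rewrite -scaler_sumr /index_sum exchange_big /=.
apply: (@eq_on_trans _ _ _ _ (ratr t.1.1 *: index_sum t.1.2 e (fun d =>
    if p (size (sink_ders 0 t.2)) (size (sink_ders 1 t.2)) (size (sink_ders 2 t.2))
    then monomial_val c (valuation F) d t.2 else 0))); last first.
  case: ifP => _; first exact: eq_on_refl.
  by rewrite /index_sum big1 ?scaler0.
apply: eq_onZ; apply: eq_on_sum => d _.
rewrite (bigD1 (q0 t d)) //= big1 ?addr0; last first.
  by move=> q /negPf qq; rewrite qq andbF mul0r.
rewrite eqxx andbT /p' /W /q0 /=.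
have /andP[_ /and4P[s0 s1 s2 _]] := st.
rewrite !mabs_mindex ?size_map //; case: ifP => _; last first.
  by rewrite mul0r.
apply: eq_on_trans (eq_on_sym (monomial_val_split d st)).
apply: eq_onM; first exact: eq_on_refl.
by apply: eq_onM; [apply: eq_onM|]; apply: mpd_mindex; rewrite ?size_map.
Qed.

Lemma op_of_symbol (e : env) T : all (fun t : term => splits t.2) T ->
  op_of c (symbol_of e T) f g h =c terms_val c (valuation F) e T.
Proof.
move=> sT; have := symbol_coefP (fun _ _ _ => true) e sT.
by rewrite filter_predT.
Qed.

Lemma restr_symbol (e : env) T i j k : all (fun t : term => splits t.2) T ->
  restr c (symbol_of e T) i j k f g h =c
  terms_val c (valuation F) e (part i j k T).
Proof.
move=> sT; have := symbol_coefP (fun a b d => [&& a == i, b == j & d == k]) e sT.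
rewrite /part (eq_filter (a2 := fun t : term => orders t.2 == (i, j, k))) //.
by move=> t; rewrite /= !xpair_eqE andbA.
Qed.

End ThreeArguments.

End Operators.
(** * Consequences of the Jacobi identity *)

Section Poisson.
Variables (R : realType) (n : nat) (N : affine_manifold R n).
Variables (P : bivector N) (c : chart R n N).
Hypothesis hc : atlas c.
Local Notation "f =c g" := (eq_on c f g) (at level 70).
Local Notation env := (label -> 'I_n).
Local Notation u := (ucoord c).

Lemma bracket_eq_on a a' b b' : a =c a' -> b =c b' ->
  bracket P c a b =c bracket P c a' b'.
Proof.
move=> Ea Eb; apply: eq_on_sum => i _; apply: eq_on_sum => j _.
by apply: eq_onM; [apply: eq_onM; [exact: eq_on_refl|]|]; exact: pd_eq_on.
Qed.

Lemma mul_pd_ucoord (a : N -> R) i j : a * pd c i (u j) =c if i == j then a else 0.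
Proof.
move=> x dx; rewrite !fctE (pd_ucoord j i dx) /cst eq_sym.
by case: eqP => _; rewrite ?mulr1 ?mulr0.
Qed.

Lemma bracket_ucoordr a d :
  bracket P c a (u d) =c \sum_k P c k d * pd c k a.
Proof.
apply: eq_on_sum => i _.
apply: (@eq_on_trans _ _ _ _ (\sum_j if j == d then P c i j * pd c i a else 0)).
  by apply: eq_on_sum => j _; exact: mul_pd_ucoord.
by rewrite -big_mkcond big_pred1_eq; exact: eq_on_refl.
Qed.

Lemma bracket_ucoordl a d :
  bracket P c (u d) a =c \sum_k P c d k * pd c k a.
Proof.
rewrite /bracket exchange_big; apply: eq_on_sum => j _.
apply: (@eq_on_trans _ _ _ _ (\sum_i if i == d then P c i j * pd c j a else 0)).
  apply: eq_on_sum => i _; rewrite mulrAC; exact: mul_pd_ucoord.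
by rewrite -big_mkcond big_pred1_eq; exact: eq_on_refl.
Qed.

Lemma bracket_ucoord a b : bracket P c (u a) (u b) =c P c a b.
Proof.
apply: eq_on_trans (bracket_ucoordr _ _) _.
apply: (@eq_on_trans _ _ _ _ (\sum_k if k == a then P c k b else 0)).
  by apply: eq_on_sum => k _; exact: mul_pd_ucoord.
by rewrite -big_mkcond big_pred1_eq; exact: eq_on_refl.
Qed.

(** The partial derivatives of the coordinate functions are Kronecker deltas. *)
Lemma Jac_ucoord a b d : Jac P c (u a) (u b) (u d) =c jacobiator P c a b d.
Proof.
rewrite /Jac /jacobiator !sumrB.
have bE i j k : bracket P c (bracket P c (u i) (u j)) (u k) =c
    \sum_l P c l k * pd c l (P c i j).
  apply: eq_on_trans (bracket_ucoordr _ _).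
  by apply: bracket_eq_on; [exact: bracket_ucoord|exact: eq_on_refl].
apply: eq_onD; first by apply: eq_onD; [|apply: eq_onN]; exact: bE.
apply: eq_onN; apply: eq_on_trans (bracket_ucoordl _ _).
by apply: bracket_eq_on; [exact: eq_on_refl|exact: bracket_ucoord].
Qed.

Lemma pds0 l : pds c l (0 : N -> R) = 0.
Proof. by elim: l => //= i l ->; exact: (pd_cst c i 0). Qed.

Hypothesis hP : poisson P.

Lemma jacobiator0 a b d : jacobiator P c a b d =c 0.
Proof.
apply: eq_on_trans (eq_on_sym (Jac_ucoord a b d)) _ => x dx.
by apply: (hP hc) => //; exact: smooth_ucoord.
Qed.

(** The Jacobi identity holds on the whole domain of the chart, which is open,
    so all derivatives of the components of the Jacobiator vanish too. *)
Lemma monomial_val_J0 F (d : env) m : has is_J_factor m -> monomial_val c (valuation P c F) d m =c 0.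
Proof.
rewrite /monomial_val; elim: m => [//|f m IH] /= /orP[Jf|/IH E] x dx; rewrite big_cons !fctE.
  rewrite (_ : factor_val _ _ _ _ x = 0) ?mul0r //; case: f Jf => [[k ls] ds].
  case: k => [|[|[|[|[|k]]]]] //; case: ls => [|a [|b [|e [|? ?]]]] // _.
  have := @pds_eq_on _ _ _ c (map d ds) _ _ (jacobiator0 (d a) (d b) (d e)).
  by rewrite pds0 => /(_ x dx).
by rewrite [X in _ * X]E // mulr0.
Qed.

Lemma symbol_coef0 (e : env) T I J K :
  all (fun t : term => has is_J_factor (coef_part t.2)) T ->
  symbol_coef P c e T I J K =c 0.
Proof.
move=> /allP H; rewrite /symbol_coef big_seq; apply: eq_on_sum0 => t /H Jt.
apply: eq_onZ0; apply: eq_on_sum0 => d _.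
by case: ifP => _; [exact: monomial_val_J0|exact: eq_on_refl].
Qed.

Lemma op_of_zero (s : symbol N) :
  (forall I J K, scoef (s := s) I J K =c 0) -> op_eq c (op_of c s) 0.
Proof.
move=> s0 f g h _ _ _; do 3![apply: eq_on_sum0 => ? _].
by do 3!apply: eq_onM0; exact: s0.
Qed.

Lemma poisson_symbol (e : env) T i j k :
  all (fun t : term => has is_J_factor (coef_part t.2)) T ->
  op_eq c (op_of c (symbol_of P c e T)) 0 /\
  op_eq c (restr c (symbol_of P c e T) i j k) 0.
Proof.
move=> H; split; apply: op_of_zero => I J K; first exact: symbol_coef0.
by move=> x dx /=; case: ifP => // _; exact: symbol_coef0.
Qed.

End Poisson.

(** * The associator at third order *)

Section Associator.
Variables (R : realType) (n : nat) (N : affine_manifold R n).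
Variables (P : bivector N) (c : chart R n N).
Implicit Types f g h : N -> R.

Lemma pd0 i : pd c i (0 : N -> R) = 0.
Proof. exact: (pd_cst c i 0). Qed.

Lemma B_0r p f : B P c p f 0 = 0.
Proof.
rewrite /B; case: (val p) => [|[|[|?]]].
- exact: mulr0.
- by do 2![apply: big1 => ? _]; rewrite pd0 mulr0.
- rewrite /B2; move: (bcomp P c) (pd c) pd0 => Q D D0.
  by do 4![apply: big1 => ? _]; rewrite !(D0, mulr0) !(addr0, scaler0).
- rewrite /B3; move: (bcomp P c) (pd c) pd0 => Q D D0.
  by do 6![apply: big1 => ? _]; rewrite !(D0, mulr0) !(addr0, scaler0).
Qed.

Lemma B_0l p f : B P c p 0 f = 0.
Proof.
rewrite /B; case: (val p) => [|[|[|?]]].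
- exact: mul0r.
- by do 2![apply: big1 => ? _]; rewrite pd0 mulr0 mul0r.
- rewrite /B2; move: (bcomp P c) (pd c) pd0 => Q D D0.
  by do 4![apply: big1 => ? _]; rewrite !(D0, mulr0, mul0r) !(addr0, scaler0).
- rewrite /B3; move: (bcomp P c) (pd c) pd0 => Q D D0.
  by do 6![apply: big1 => ? _]; rewrite !(D0, mulr0, mul0r) !(addr0, scaler0).
Qed.

Lemma star_hconstr F h m : star P c F (hconst h) m =
  \sum_(p < 4) \sum_(q < 4) if (p + q == m)%N then B P c p (F q) h else 0.
Proof.
apply: eq_bigr => p _; apply: eq_bigr => q _.
rewrite big_mkcond big_ord_recl big1 => [|r _]; first by rewrite /= addr0 addn0.
by rewrite /hconst /= B_0r if_same.
Qed.

Lemma star_hconstl F f m : star P c (hconst f) F m =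
  \sum_(p < 4) \sum_(q < 4) if (p + q == m)%N then B P c p f (F q) else 0.
Proof.
apply: eq_bigr => p _; rewrite big_ord_recl [X in _ + X]big1 => [|q _].
  by rewrite /= addr0 big_mkcond; apply: eq_bigr => r _; rewrite /= addn0.
by rewrite big1 // => r _; rewrite /hconst /= B_0l.
Qed.

Lemma star_hconst f g m : star P c (hconst f) (hconst g) m = B P c m f g.
Proof.
rewrite star_hconstr.
rewrite (eq_bigr (fun p : 'I_4 => if p == m then B P c p f g else 0)).
  by rewrite -big_mkcond big_pred1_eq.
move=> p _; rewrite big_ord_recl big1 => [|q _]; first by rewrite /= addr0 addn0.
by rewrite /hconst /= B_0l if_same.
Qed.

Lemma sum_degree3 (X : nmodType) (E : 'I_4 -> 'I_4 -> X) :
  let o k lt_k := @Ordinal 4 k lt_k in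
  \sum_(p < 4) \sum_(q < 4) (if (p + q == @ord_max 3)%N then E p q else 0) =
  E (o 0%N isT) (o 3 isT) + E (o 1%N isT) (o 2 isT) +
  E (o 2 isT) (o 1%N isT) + E (o 3 isT) (o 0%N isT).
Proof.
move=> o; transitivity (\sum_(p < 4) E p (rev_ord p)).
  apply: eq_bigr => p _; rewrite -big_mkcond (big_pred1 (rev_ord p)) // => q.
  rewrite /= -val_eqE /=; case: p q => [p lp] [q lq] /=; lia.
rewrite !big_ord_recl big_ord0 addr0 !addrA.
by congr (E _ _ + E _ _ + E _ _ + E _ _); apply: val_inj.
Qed.

(** The arguments f, g, h are constant series in hbar, and each B_p vanishes if
    one of its arguments is 0; so one product remains for each p. *)
Lemma assoc3E f g h : assoc3 P c f g h =
  (B3 P c f g * h + bracket P c (B2 P c f g) h +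
   B2 P c (bracket P c f g) h + B3 P c (f * g) h) -
  (f * B3 P c g h + bracket P c f (B2 P c g h) +
   B2 P c f (bracket P c g h) + B3 P c f (g * h)).
Proof.
pose o k lt_k := @Ordinal 4 k lt_k.
have El F : star P c F (hconst h) ord_max =
    B P c (o 0%N isT) (F (o 3 isT)) h + B P c (o 1%N isT) (F (o 2 isT)) h +
    B P c (o 2 isT) (F (o 1%N isT)) h + B P c (o 3 isT) (F (o 0%N isT)) h.
  rewrite star_hconstr; exact: (sum_degree3 (fun p q => B P c p (F q) h)).
have Er F : star P c (hconst f) F ord_max =
    B P c (o 0%N isT) f (F (o 3 isT)) + B P c (o 1%N isT) f (F (o 2 isT)) +
    B P c (o 2 isT) f (F (o 1%N isT)) + B P c (o 3 isT) f (F (o 0%N isT)).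
  rewrite star_hconstl; exact: (sum_degree3 (fun p q => B P c p f (F q))).
rewrite /assoc3 -[LHS]/(star P c (star P c (hconst f) (hconst g)) (hconst h) ord_max
  - star P c (hconst f) (star P c (hconst g) (hconst h)) ord_max).
by rewrite El Er !star_hconst.
Qed.

(** The expression follows the formulas for B_2 and B_3 literally, so both sides
    are convertible. *)
Lemma assoc3_denote (e : label -> 'I_n) f g h :
  assoc3 P c f g h = denote c (valuation P c [:: f; g; h]) e assoc3_exp.
Proof. by rewrite assoc3E. Qed.

End Associator.
(** * The thirty-nine graphs *)

(** The collected terms of the associator, listed so that the later computations
    need not collect them again. *)
Definition A_list : gsum := [::
  (1 / 3, [:: (4, 2); (0, 1); (0, 4)]%N);
  (1 / 3, [:: (5, 2); (0, 1); (4, 1)]%N);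
  (1 / 6, [:: (5, 2); (0, 5); (4, 1)]%N);
  (- (1 / 3), [:: (0, 5); (1, 2); (1, 4)]%N);
  (- (1 / 3), [:: (0, 4); (1, 2); (4, 2)]%N);
  (- (1 / 6), [:: (0, 4); (1, 5); (4, 2)]%N);
  (1 / 3, [:: (0, 2); (5, 3); (0, 1)]%N);
  (1 / 3, [:: (5, 2); (1, 3); (0, 1)]%N);
  (1 / 3, [:: (5, 2); (3, 2); (0, 1)]%N);
  (1 / 6, [:: (5, 4); (3, 2); (0, 1)]%N);
  (- (2 / 3), [:: (0, 5); (0, 1); (1, 2)]%N);
  (- (1 / 3), [:: (0, 5); (0, 3); (1, 2)]%N);
  (2 / 3, [:: (0, 1); (3, 2); (1, 2)]%N);
  (- (1 / 3), [:: (0, 2); (3, 5); (1, 2)]%N);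
  (- (1 / 3), [:: (0, 5); (3, 1); (1, 2)]%N);
  (- (1 / 6), [:: (0, 4); (3, 5); (1, 2)]%N);
  (- (1 / 6), [:: (1, 2); (0, 3); (4, 3)]%N);
  (1 / 3, [:: (0, 2); (1, 3); (0, 3)]%N);
  (- (1 / 3), [:: (1, 2); (0, 3); (0, 3)]%N);
  (2 / 3, [:: (0, 2); (1, 3); (1, 2)]%N);
  (- (2 / 3), [:: (1, 2); (0, 3); (0, 2)]%N);
  (- (2 / 3), [:: (1, 2); (0, 3); (1, 2)]%N);
  (1 / 6, [:: (0, 4); (3, 2); (1, 4)]%N);
  (1 / 6, [:: (0, 2); (3, 2); (1, 4)]%N);
  (- (1 / 6), [:: (1, 2); (3, 2); (0, 4)]%N);
  (1 / 6, [:: (0, 2); (1, 3); (4, 2)]%N);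
  (- (1 / 6), [:: (1, 2); (0, 3); (4, 2)]%N);
  (1 / 6, [:: (0, 1); (3, 2); (3, 4)]%N);
  (1 / 3, [:: (0, 1); (3, 2); (3, 2)]%N);
  (- (1 / 3), [:: (0, 2); (3, 2); (3, 1)]%N);
  (2 / 3, [:: (0, 1); (3, 2); (0, 1)]%N);
  (2 / 3, [:: (0, 1); (3, 2); (0, 2)]%N);
  (- (2 / 3), [:: (0, 2); (3, 1); (0, 1)]%N);
  (- (2 / 3), [:: (0, 2); (3, 1); (0, 2)]%N);
  (- (1 / 6), [:: (0, 4); (3, 2); (3, 1)]%N);
  (1 / 6, [:: (0, 1); (3, 2); (0, 4)]%N);
  (- (1 / 6), [:: (0, 2); (3, 1); (0, 4)]%N);
  (1 / 6, [:: (0, 1); (0, 3); (4, 2)]%N);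
  (- (1 / 6), [:: (0, 2); (0, 3); (4, 1)]%N)].
Lemma A_termsE : A_terms = A_list.
Proof. by apply/eqP; vm_cast_no_check (erefl true). Qed.

Definition A_expansion : seq term := graph_terms A_list.

Lemma A_list_orders :
  all (fun x : rat * graph => order3 x.2 == orders (graph_mon x.2)) A_list.
Proof. by vm_compute. Qed.

Lemma A_list_three : three_sized A_list.
Proof. by vm_compute. Qed.

Lemma part_graph_terms i j k (S : gsum) :
  all (fun x : rat * graph => order3 x.2 == orders (graph_mon x.2)) S ->
  graph_terms [seq x <- S | order3 x.2 == (i, j, k)] = part i j k (graph_terms S).
Proof.
rewrite /part /graph_terms; elim: S => [//|x S IH] /= /andP[/eqP <- /IH <-].
by case: ifP.
Qed.

(** * Operators given by lists of terms *)

Section Representation.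
Variables (R : realType) (n : nat) (N : affine_manifold R n).
Variables (P : bivector N) (c : chart R n N).
Hypothesis hc : atlas c.
Variable e : label -> 'I_n.
Local Notation "f =c g" := (eq_on c f g) (at level 70).
Implicit Types (X Y : triop N) (T U : seq term).

Definition represents X T : Prop := forall f g h : N -> R,
  smooth_on c f -> smooth_on c g -> smooth_on c h ->
  X f g h =c terms_val c (valuation P c [:: f; g; h]) e T.

Lemma represents_exp X x :
  (forall f g h, X f g h = denote c (valuation P c [:: f; g; h]) e x) ->
  no_capture x -> represents X (norm x).
Proof.
move=> E nx f g h sf sg sh; rewrite E.
exact: (normP (valuation_smooth P hc (arguments_smooth sf sg sh)) e nx).
Qed.

Lemma represents_agree X T U : represents X T -> agree T U -> represents X U.
Proof.
move=> XT TU f g h sf sg sh; apply: eq_on_trans (XT f g h sf sg sh) _.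
exact: (agreeP (valuation_smooth P hc (arguments_smooth sf sg sh))
  (valuation_skew P hc _) e TU).
Qed.

Lemma represents_unfold X T : all unfoldable T ->
  represents X T <-> represents X (unfold_terms T).
Proof.
move=> uT; split=> XT f g h sf sg sh;
  have E := unfold_termsP P hc (arguments_smooth sf sg sh) e uT.
  exact: eq_on_trans (XT f g h sf sg sh) E.
exact: eq_on_trans (XT f g h sf sg sh) (eq_on_sym E).
Qed.

Lemma represents_eq X Y T U : represents X T -> represents Y U -> agree T U ->
  op_eq c X Y.
Proof.
move=> XT YU TU f g h sf sg sh.
apply: eq_on_trans (represents_agree XT TU sf sg sh) _.
exact: eq_on_sym (YU f g h sf sg sh).
Qed.

Lemma represents_scale q (a : R) X T : a = ratr q -> represents X T ->
  represents (a *: X) (scale_terms q T).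
Proof.
move=> -> XT f g h sf sg sh; rewrite terms_val_scale; apply: eq_onZ; exact: XT.
Qed.

Lemma representsD X Y T U : represents X T -> represents Y U ->
  represents (X + Y) (T ++ U).
Proof.
move=> XT YU f g h sf sg sh; rewrite terms_val_cat.
by apply: eq_onD; [exact: XT|exact: YU].
Qed.

Lemma representsB X Y T U : represents X T -> represents Y U ->
  represents (X - Y) (T ++ scale_terms (-1) U).
Proof.
move=> XT YU; apply: representsD => // f g h sf sg sh.
rewrite terms_val_scale rmorphN1 scaleN1r; apply: eq_onN; exact: YU.
Qed.

Lemma represents_op_of T : all (fun t : term => splits t.2) T ->
  represents (op_of c (symbol_of P c e T)) T.
Proof. by move=> sT f g h sf sg sh; exact: op_of_symbol. Qed.

Lemma represents_restr i j k T : all (fun t : term => splits t.2) T ->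
  represents (restr c (symbol_of P c e T) i j k) (part i j k T).
Proof. by move=> sT f g h sf sg sh; exact: restr_symbol. Qed.

Lemma represents_gsum S : three_sized S ->
  represents (gsum_eval P c S) (graph_terms S).
Proof. by move=> sS f g h sf sg sh; exact: gsum_eval_terms. Qed.
End Representation.
(** * Finite computations *)

(** The properties of a list of terms which make [symbol_of] a symbol whose
    coefficients vanish for a Poisson bivector. *)
Definition Jac_terms (T : seq term) : bool :=
  all (fun t : term => [&& splits t.2, unfoldable t & has is_J_factor (coef_part t.2)]) T.

Lemma Jac_terms_all : all Jac_terms [:: S_f_terms; S_g_terms; S_h_terms; I_f_terms;
  I_g_terms; I_h_terms].
Proof. by vm_compute. Qed.

Lemma A_expansion_splits : all (fun t : term => splits t.2) A_expansion.
Proof. by vm_compute. Qed.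

Lemma exp_no_capture : all no_capture [:: assoc3_exp; S_f_exp; S_g_exp; S_h_exp; I_f_exp;
  I_g_exp; I_h_exp;
  tadpole_f_exp; tadpole_h_exp].
Proof. by vm_compute. Qed.

(** This compares the Leibniz expansion of the composed bidifferential operators
    with the collected graphs. *)
Lemma assoc3_agree : agree (norm assoc3_exp) A_expansion.
Proof. vm_cast_no_check (erefl true). Qed.
Lemma S_f_agree : agree (norm S_f_exp) (unfold_terms S_f_terms).
Proof. vm_cast_no_check (erefl true). Qed.
Lemma S_g_agree : agree (norm S_g_exp) (unfold_terms S_g_terms).
Proof. vm_cast_no_check (erefl true). Qed.
Lemma S_h_agree : agree (norm S_h_exp) (unfold_terms S_h_terms).
Proof. vm_cast_no_check (erefl true). Qed.
Lemma I_f_agree : agree (norm I_f_exp) (unfold_terms I_f_terms).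
Proof. vm_cast_no_check (erefl true). Qed.
Lemma I_g_agree : agree (norm I_g_exp) (unfold_terms I_g_terms).
Proof. vm_cast_no_check (erefl true). Qed.
Lemma I_h_agree : agree (norm I_h_exp) (unfold_terms I_h_terms).
Proof. vm_cast_no_check (erefl true). Qed.

Definition sub_terms (T U : seq term) : seq term := T ++ scale_terms (-1) U.

(** The seven equalities between restrictions need no Jacobi identity: the
    canonical forms agree once the components of the Jacobiator are unfolded. *)
Lemma A_221_agree : agree (part 2 2 1 A_expansion)
  (scale_terms (2 / 3) (unfold_terms (part 2 2 1 S_f_terms))).
Proof. vm_cast_no_check (erefl true). Qed.
Lemma A_122_agree : agree (part 1 2 2 A_expansion)
  (scale_terms (2 / 3) (unfold_terms (part 1 2 2 S_g_terms))).
Proof. vm_cast_no_check (erefl true). Qed.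
Lemma A_212_agree : agree (part 2 1 2 A_expansion)
  (scale_terms (- (2 / 3)) (unfold_terms (part 2 1 2 S_h_terms))).
Proof. vm_cast_no_check (erefl true). Qed.
Lemma A_111_agree : agree (part 1 1 1 A_expansion)
  (scale_terms (1 / 6)
    (sub_terms (sub_terms (unfold_terms (part 1 1 1 I_f_terms)) (norm tadpole_f_exp))
               (sub_terms (unfold_terms (part 1 1 1 I_h_terms)) (norm tadpole_h_exp)))).
Proof. vm_cast_no_check (erefl true). Qed.
Lemma A_112_agree : agree (part 1 1 2 A_expansion)
  (sub_terms
    (scale_terms (1 / 6) (unfold_terms (part 1 1 2 I_f_terms)) ++
     scale_terms (1 / 6) (unfold_terms (part 1 1 2 I_g_terms)))
    (scale_terms (1 / 3) (unfold_terms (part 1 1 2 S_h_terms)))).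
Proof. vm_cast_no_check (erefl true). Qed.
Lemma A_121_agree : agree (part 1 2 1 A_expansion)
  (scale_terms (1 / 3) (sub_terms (unfold_terms (part 1 2 1 I_f_terms))
                                  (unfold_terms (part 1 2 1 I_h_terms)))).
Proof. vm_cast_no_check (erefl true). Qed.
Lemma A_211_agree : agree (part 2 1 1 A_expansion)
  (sub_terms
    (sub_terms (scale_terms (1 / 3) (unfold_terms (part 2 1 1 S_f_terms)))
               (scale_terms (1 / 6) (unfold_terms (part 2 1 1 I_g_terms))))
    (scale_terms (1 / 6) (unfold_terms (part 2 1 1 I_h_terms)))).
Proof. vm_cast_no_check (erefl true). Qed.

Lemma A_expansion_parts_agree : agree A_expansion
  (part 2 2 1 A_expansion ++ part 1 2 2 A_expansion ++ part 2 1 2 A_expansion ++ part 1 1 1 A_expansion ++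
   part 1 1 2 A_expansion ++ part 1 2 1 A_expansion ++ part 2 1 1 A_expansion).
Proof. vm_cast_no_check (erefl true). Qed.

Lemma all_filterW (I : Type) (p q : pred I) (s : seq I) : all p s -> all p [seq x <- s | q x].
Proof. by rewrite all_filter; apply: sub_all => x /= ->; exact: implybT. Qed.

(** * The factorization of the associator *)

Lemma ratr_frac (R : realType) (a b : nat) :
  a%:R / b%:R = ratr (a%:R / b%:R) :> R.
Proof.
by rewrite rmorphM fmorphV !rmorph_nat.
Qed.

Section Factorization.
Variables (R : realType) (n : nat) (N : affine_manifold R n).
Variables (P : bivector N) (c : chart R n N).

(** The part of the theorem which speaks of operators. *)
Definition associator_factorization : Prop :=
  op_eq c (assoc3 P c) (gsum_eval P c A_terms) /\
  exists A Sf Sg Sh If Ig Ih : symbol N,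
    op_eq c (assoc3 P c) (op_of c A) /\
    [/\ op_eq c (S_f P c) (op_of c Sf), op_eq c (S_g P c) (op_of c Sg) &
        op_eq c (S_h P c) (op_of c Sh)] /\
    [/\ op_eq c (I_f P c) (op_of c If), op_eq c (I_g P c) (op_of c Ig) &
        op_eq c (I_h P c) (op_of c Ih)] /\
    (forall i j k : nat,
      op_eq c (restr c A i j k) (gsum_eval P c (A_terms_of i j k))) /\
    [/\ op_eq c (restr c A 2 2 1) ((2 / 3) *: restr c Sf 2 2 1),
        op_eq c (restr c A 1 2 2) ((2 / 3) *: restr c Sg 1 2 2) &
        op_eq c (restr c A 2 1 2) (- (2 / 3) *: restr c Sh 2 1 2)] /\
    op_eq c (restr c A 1 1 1)
      ((1 / 6) *: ((restr c If 1 1 1 - tadpole_f P c)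
                   - (restr c Ih 1 1 1 - tadpole_h P c))) /\
    op_eq c (restr c A 1 1 2)
      ((1 / 6) *: restr c If 1 1 2 + (1 / 6) *: restr c Ig 1 1 2
       - (1 / 3) *: restr c Sh 1 1 2) /\
    op_eq c (restr c A 1 2 1)
      ((1 / 3) *: (restr c If 1 2 1 - restr c Ih 1 2 1)) /\
    op_eq c (restr c A 2 1 1)
      ((1 / 3) *: restr c Sf 2 1 1 - (1 / 6) *: restr c Ig 2 1 1
       - (1 / 6) *: restr c Ih 2 1 1) /\
    (poisson P ->
      [/\ op_eq c (S_f P c) 0, op_eq c (S_g P c) 0 & op_eq c (S_h P c) 0] /\
      [/\ op_eq c (I_f P c) 0, op_eq c (I_g P c) 0 & op_eq c (I_h P c) 0] /\
      (forall i j k : nat,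
        [/\ op_eq c (restr c Sf i j k) 0, op_eq c (restr c Sg i j k) 0 &
            op_eq c (restr c Sh i j k) 0] /\
        [/\ op_eq c (restr c If i j k) 0, op_eq c (restr c Ig i j k) 0 &
            op_eq c (restr c Ih i j k) 0]) /\
      op_eq c (tadpole_f P c) 0 /\ op_eq c (tadpole_h P c) 0 /\
      op_eq c (restr c A 1 1 1)
        ((1 / 6) *: (restr c If 1 1 1 - restr c Ih 1 1 1)) /\
      op_eq c (assoc3 P c) 0).

Implicit Types X Y Z : triop N.

Lemma op_eq_trans Y X Z : op_eq c X Y -> op_eq c Y Z -> op_eq c X Z.
Proof. by move=> XY YZ f g h sf sg sh x dx; rewrite XY // YZ. Qed.

Lemma op_eqD X X' Y Y' : op_eq c X X' -> op_eq c Y Y' -> op_eq c (X + Y) (X' + Y').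
Proof.
move=> XX YY f g h sf sg sh; exact: (eq_onD (XX f g h sf sg sh) (YY f g h sf sg sh)).
Qed.

Lemma op_eqN X X' : op_eq c X X' -> op_eq c (- X) (- X').
Proof. by move=> XX f g h sf sg sh; exact: (eq_onN (XX f g h sf sg sh)). Qed.

Lemma op_eqB X X' Y Y' : op_eq c X X' -> op_eq c Y Y' -> op_eq c (X - Y) (X' - Y').
Proof. by move=> XX /op_eqN; exact: op_eqD. Qed.

Lemma op_eqZ (a : R) X X' : op_eq c X X' -> op_eq c (a *: X) (a *: X').
Proof. by move=> XX f g h sf sg sh; exact: (eq_onZ a (XX f g h sf sg sh)). Qed.

Lemma op_eqD0 X Y : op_eq c X 0 -> op_eq c Y 0 -> op_eq c (X + Y) 0.
Proof. by move=> X0 Y0; rewrite -(addr0 0); exact: op_eqD. Qed.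

Lemma op_eqB0 X Y : op_eq c X 0 -> op_eq c Y 0 -> op_eq c (X - Y) 0.
Proof. by move=> X0 Y0; rewrite -(subr0 0); exact: op_eqB. Qed.

Lemma op_eqZ0 (a : R) X : op_eq c X 0 -> op_eq c (a *: X) 0.
Proof. by move=> X0; rewrite -(scaler0 _ a); exact: op_eqZ. Qed.

Hypothesis hc : atlas c.

Lemma tadpole0 : poisson P ->
  op_eq c (tadpole_f P c) 0 /\ op_eq c (tadpole_h P c) 0.
Proof.
move=> hP; have sP i j : smooth_on c (pd c j (P c i j)).
  exact: (smooth_pd _ (P_smooth P hc _ _)).
split=> f g h sf sg sh; apply: eq_on_sum0 => i _; apply: eq_on_sum0 => j _;
  apply: eq_onM0 => x dx.
  exact: (hP c hc _ _ _ (sP i j) sg sh x dx).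
exact: (hP c hc _ _ _ sf sg (sP i j) x dx).
Qed.

(* An assignment [e] of values to all indices exists only in positive dimension.
   It serves to evaluate terms with unbound indices; the result does not
   depend on it for the terms used here. *)
Section PositiveDimension.
Variable e : label -> 'I_n.
Local Notation rep := (represents P c e).
Local Notation sym := (symbol_of P c e).

Lemma Jac_terms_splits T : Jac_terms T -> all (fun t : term => splits t.2) T.
Proof. by apply: sub_all => t /and3P[]. Qed.

Lemma Jac_terms_unfoldable T : Jac_terms T -> all unfoldable T.
Proof. by apply: sub_all => t /and3P[]. Qed.

Lemma Jac_terms_J_factor T : Jac_terms T ->
  all (fun t : term => has is_J_factor (coef_part t.2)) T.
Proof. by apply: sub_all => t /and3P[]. Qed.

Lemma rep_restr i j k T : Jac_terms T ->
  rep (restr c (sym T) i j k) (unfold_terms (part i j k T)).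
Proof.
move=> JT; have uT : all unfoldable (part i j k T).
  exact: (all_filterW _ (Jac_terms_unfoldable JT)).
apply: (represents_unfold P hc e _ uT).1.
exact: (represents_restr P e i j k (Jac_terms_splits JT)).
Qed.

Lemma op_eq_symbol X x T :
  (forall f g h, X f g h = denote c (valuation P c [:: f; g; h]) e x) ->
  no_capture x -> agree (norm x) (unfold_terms T) -> Jac_terms T ->
  op_eq c X (op_of c (sym T)).
Proof.
move=> E nx a JT; apply: (represents_eq hc (represents_exp hc E nx) _ a).
apply: (represents_unfold P hc e _ (Jac_terms_unfoldable JT)).1.
exact: (represents_op_of P e (Jac_terms_splits JT)).
Qed.

Lemma associator_factorization_pos : associator_factorization.
Proof.
have /and5P[JSf JSg JSh JIf /and3P[JIg JIh _]] := Jac_terms_all.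
have /and5P[nA nSf nSg nSh /and5P[nIf nIg nIh nTf /andP[nTh _]]] := exp_no_capture.
have rA : rep (assoc3 P c) A_expansion.
  apply: (represents_agree hc _ assoc3_agree).
  by apply: (represents_exp hc _ nA) => f g h; exact: assoc3_denote.
have rTf : rep (tadpole_f P c) (norm tadpole_f_exp) by exact: (represents_exp hc _ nTf).
have rTh : rep (tadpole_h P c) (norm tadpole_h_exp) by exact: (represents_exp hc _ nTh).
have rAr i j k : rep (restr c (sym A_expansion) i j k) (part i j k A_expansion).
  exact: (represents_restr P e i j k A_expansion_splits).
have q23 : 2 / 3 = ratr (2 / 3) :> R := ratr_frac R 2 3.
have q13 : 1 / 3 = ratr (1 / 3) :> R := ratr_frac R 1 3.
have q16 : 1 / 6 = ratr (1 / 6) :> R := ratr_frac R 1 6.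
have q23N : - (2 / 3) = ratr (- (2 / 3)) :> R by rewrite raddfN q23.
have eSf : op_eq c (S_f P c) (op_of c (sym S_f_terms)).
  by apply: (op_eq_symbol _ nSf S_f_agree JSf).
have eSg : op_eq c (S_g P c) (op_of c (sym S_g_terms)).
  by apply: (op_eq_symbol _ nSg S_g_agree JSg).
have eSh : op_eq c (S_h P c) (op_of c (sym S_h_terms)).
  by apply: (op_eq_symbol _ nSh S_h_agree JSh).
have eIf : op_eq c (I_f P c) (op_of c (sym I_f_terms)).
  by apply: (op_eq_symbol _ nIf I_f_agree JIf).
have eIg : op_eq c (I_g P c) (op_of c (sym I_g_terms)).
  by apply: (op_eq_symbol _ nIg I_g_agree JIg).
have eIh : op_eq c (I_h P c) (op_of c (sym I_h_terms)).
  by apply: (op_eq_symbol _ nIh I_h_agree JIh).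
have e111 : op_eq c (restr c (sym A_expansion) 1 1 1)
   ((1 / 6) *: ((restr c (sym I_f_terms) 1 1 1 - tadpole_f P c)
                   - (restr c (sym I_h_terms) 1 1 1 - tadpole_h P c))).
  apply: (represents_eq hc (rAr _ _ _) _ A_111_agree).
  apply: (represents_scale q16); apply: representsB.
    by apply: representsB rTf; exact: rep_restr.
  by apply: representsB rTh; exact: rep_restr.
have e221 : op_eq c (restr c (sym A_expansion) 2 2 1) ((2 / 3) *: restr c (sym S_f_terms) 2 2 1).
  apply: (represents_eq hc (rAr _ _ _) _ A_221_agree).
  by apply: (represents_scale q23); exact: rep_restr.
have e122 : op_eq c (restr c (sym A_expansion) 1 2 2) ((2 / 3) *: restr c (sym S_g_terms) 1 2 2).
  apply: (represents_eq hc (rAr _ _ _) _ A_122_agree).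
  by apply: (represents_scale q23); exact: rep_restr.
have e212 : op_eq c (restr c (sym A_expansion) 2 1 2) (- (2 / 3) *: restr c (sym S_h_terms) 2 1 2).
  apply: (represents_eq hc (rAr _ _ _) _ A_212_agree).
  by apply: (represents_scale q23N); exact: rep_restr.
have e112 : op_eq c (restr c (sym A_expansion) 1 1 2)
    ((1 / 6) *: restr c (sym I_f_terms) 1 1 2 + (1 / 6) *: restr c (sym I_g_terms) 1 1 2
       - (1 / 3) *: restr c (sym S_h_terms) 1 1 2).
  apply: (represents_eq hc (rAr _ _ _) _ A_112_agree).
  apply: representsB; [apply: representsD|].
  - by apply: (represents_scale q16); exact: rep_restr.
  - by apply: (represents_scale q16); exact: rep_restr.
  - by apply: (represents_scale q13); exact: rep_restr.
have e121 : op_eq c (restr c (sym A_expansion) 1 2 1)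
    ((1 / 3) *: (restr c (sym I_f_terms) 1 2 1 - restr c (sym I_h_terms) 1 2 1)).
  apply: (represents_eq hc (rAr _ _ _) _ A_121_agree).
  by apply: (represents_scale q13); apply: representsB; exact: rep_restr.
have e211 : op_eq c (restr c (sym A_expansion) 2 1 1)
    ((1 / 3) *: restr c (sym S_f_terms) 2 1 1 - (1 / 6) *: restr c (sym I_g_terms) 2 1 1
       - (1 / 6) *: restr c (sym I_h_terms) 2 1 1).
  apply: (represents_eq hc (rAr _ _ _) _ A_211_agree).
  apply: representsB; [apply: representsB|].
  - by apply: (represents_scale q13); exact: rep_restr.
  - by apply: (represents_scale q16); exact: rep_restr.
  - by apply: (represents_scale q16); exact: rep_restr.
split.
  rewrite A_termsE => f g h sf sg sh.
  apply: eq_on_trans (rA f g h sf sg sh) _; apply: eq_on_sym.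
  exact: (represents_gsum P hc e A_list_three).
exists (sym A_expansion), (sym S_f_terms), (sym S_g_terms), (sym S_h_terms), (sym I_f_terms), (sym I_g_terms), (sym I_h_terms).
split.
  move=> f g h sf sg sh; apply: eq_on_trans (rA f g h sf sg sh) _; apply: eq_on_sym.
  exact: (represents_op_of P e A_expansion_splits).
split; first exact: And3 eSf eSg eSh.
split; first exact: And3 eIf eIg eIh.
split.
  move=> i j k f g h sf sg sh.
  apply: eq_on_trans (rAr i j k f g h sf sg sh) _; apply: eq_on_sym.
  rewrite -(part_graph_terms i j k A_list_orders).
  rewrite /A_terms_of A_termsE; apply: (represents_gsum P hc e _ sf sg sh).
  exact: (all_filterW _ A_list_three).
split; first exact: And3 e221 e122 e212.
split; first exact: e111.
split; first exact: e112.
split; first exact: e121.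
split; first exact: e211.
move=> hP.
have z T i j k : Jac_terms T -> op_eq c (op_of c (sym T)) 0 /\
    op_eq c (restr c (sym T) i j k) 0.
  by move=> /Jac_terms_J_factor; exact: (poisson_symbol hc hP).
have zr T i j k JT := (z T i j k JT).2.
have zo T JT := (z T 0%N 0%N 0%N JT).1.
have [tf0 th0] := tadpole0 hP.
split; first by split; [apply: op_eq_trans eSf _|apply: op_eq_trans eSg _|
  apply: op_eq_trans eSh _]; exact: zo.
split; first by split; [apply: op_eq_trans eIf _|apply: op_eq_trans eIg _|
  apply: op_eq_trans eIh _]; exact: zo.
split; first by move=> i j k; split; split; exact: zr.
split; first exact: tf0.
split; first exact: th0.
have f111 : op_eq c (restr c (sym A_expansion) 1 1 1)
    ((1 / 6) *: (restr c (sym I_f_terms) 1 1 1 - restr c (sym I_h_terms) 1 1 1)).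
  apply: op_eq_trans e111 _; apply: op_eqZ.
  rewrite -[X in op_eq c _ (X - _)]subr0 -[X in op_eq c _ (_ - X)]subr0.
  by apply: op_eqB; apply: op_eqB.
split; first exact: f111.
apply: (@op_eq_trans (restr c (sym A_expansion) 2 2 1 + (restr c (sym A_expansion) 1 2 2 +
  (restr c (sym A_expansion) 2 1 2 + (restr c (sym A_expansion) 1 1 1 + (restr c (sym A_expansion) 1 1 2 +
  (restr c (sym A_expansion) 1 2 1 + restr c (sym A_expansion) 2 1 1))))))).
  apply: (represents_eq hc rA _ A_expansion_parts_agree).
  by do 6!(apply: representsD; first exact: rAr); exact: rAr.
apply: op_eqD0; first by apply: op_eq_trans e221 _; apply: op_eqZ0; exact: zr.
apply: op_eqD0; first by apply: op_eq_trans e122 _; apply: op_eqZ0; exact: zr.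
apply: op_eqD0; first by apply: op_eq_trans e212 _; apply: op_eqZ0; exact: zr.
apply: op_eqD0; first by apply: op_eq_trans f111 _; apply: op_eqZ0; apply: op_eqB0; exact: zr.
apply: op_eqD0.
  by apply: op_eq_trans e112 _; apply: op_eqB0; [apply: op_eqD0|]; apply: op_eqZ0; exact: zr.
apply: op_eqD0; first by apply: op_eq_trans e121 _; apply: op_eqZ0; apply: op_eqB0; exact: zr.
by apply: op_eq_trans e211 _; apply: op_eqB0; [apply: op_eqB0|]; apply: op_eqZ0; exact: zr.
Qed.

End PositiveDimension.

(** Without coordinates every sum over indices is empty, so all the operators
    vanish. *)
Lemma associator_factorization_dim0 : n = 0%N -> associator_factorization.
Proof.
move=> n0.
have absurd (i : 'I_n) : False by case: i => m; rewrite n0.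
have sum0 (F : 'I_n -> N -> R) : \sum_i F i = 0.
  by rewrite big1 // => i; case: (absurd i).
have op0 X : (forall f g h, X f g h = 0) -> op_eq c X 0.
  by move=> X0 f g h _ _ _ x _; rewrite X0.
have op00 X Y : op_eq c X 0 -> op_eq c Y 0 -> op_eq c X Y.
  by move=> X0 Y0 f g h sf sg sh x dx; rewrite X0 // Y0.
have zA : op_eq c (assoc3 P c) 0.
  apply: op0 => f g h; rewrite assoc3E.
  have b0 u v : bracket P c u v = 0 by exact: sum0.
  have B20 u v : B2 P c u v = 0 by exact: sum0.
  have B30 u v : B3 P c u v = 0 by exact: sum0.
  by rewrite !b0 !B20 !B30 mul0r mulr0 !addr0 subr0.
have zG S : three_sized S -> op_eq c (gsum_eval P c S) 0.
  move=> /allP S3; apply: op0 => f g h; rewrite /gsum_eval big_seq big1 // => x.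
  move=> /S3 /eqP x3; rewrite /geval big1 ?scaler0 // => idx _.
  have a : 'I_(size x.2) by rewrite x3; exact: ord0.
  by case: (absurd (idx (a, true))).
have zT i j k : op_eq c (gsum_eval P c (A_terms_of i j k)) 0.
  by apply: zG; rewrite /A_terms_of A_termsE; exact: (all_filterW _ A_list_three).
pose Z : symbol N := @Symbol R n N 0 (fun _ _ _ => 0).
have zZ : op_eq c (op_of c Z) 0 by exact: op_of_zero.
have zr i j k : op_eq c (restr c Z i j k) 0.
  by apply: op_of_zero => I J K; rewrite /= if_same; exact: eq_on_refl.
have zS : [/\ op_eq c (S_f P c) 0, op_eq c (S_g P c) 0 & op_eq c (S_h P c) 0].
  by split; apply: op0 => f g h; exact: sum0.
have zI : [/\ op_eq c (I_f P c) 0, op_eq c (I_g P c) 0 & op_eq c (I_h P c) 0].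
  by split; apply: op0 => f g h; exact: sum0.
have zt : op_eq c (tadpole_f P c) 0 /\ op_eq c (tadpole_h P c) 0.
  by split; apply: op0 => f g h; exact: sum0.
have [zSf zSg zSh] := zS; have [zIf zIg zIh] := zI; have [ztf zth] := zt.
split; first by apply: (op00 _ _ zA); apply: zG; rewrite A_termsE; exact: A_list_three.
exists Z, Z, Z, Z, Z, Z, Z.
split; first exact: op00 zA zZ.
split; first by split; [exact: op00 zSf zZ|exact: op00 zSg zZ|exact: op00 zSh zZ].
split; first by split; [exact: op00 zIf zZ|exact: op00 zIg zZ|exact: op00 zIh zZ].
split; first by move=> i j k; exact: op00 (zr i j k) (zT i j k).
split; first by split; apply: (op00 _ _ (zr _ _ _)); apply: op_eqZ0; exact: zr.
split.
  apply: (op00 _ _ (zr _ _ _)); apply: op_eqZ0.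
  by apply: op_eqB0; apply: op_eqB0 => //; exact: zr.
split.
  apply: (op00 _ _ (zr _ _ _)); apply: op_eqB0; first apply: op_eqD0;
    by apply: op_eqZ0; exact: zr.
split.
  by apply: (op00 _ _ (zr _ _ _)); apply: op_eqZ0; apply: op_eqB0; exact: zr.
split.
  apply: (op00 _ _ (zr _ _ _)); apply: op_eqB0; first apply: op_eqB0;
    by apply: op_eqZ0; exact: zr.
move=> _; split; first exact: zS.
split; first exact: zI.
split; first by move=> i j k; split; split; exact: zr.
split; first exact: ztf.
split; first exact: zth.
split; last exact: zA.
by apply: (op00 _ _ (zr _ _ _)); apply: op_eqZ0; apply: op_eqB0; exact: zr.
Qed.

End Factorization.

Lemma A_terms_sizes :
  size A_terms = 39%N /\
  [/\ size (A_terms_of 2 2 1) = 3%N, size (A_terms_of 1 2 2) = 3%N &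
      size (A_terms_of 2 1 2) = 3%N] /\
  [/\ size (A_terms_of 1 1 1) = 8%N, size (A_terms_of 1 1 2) = 9%N,
      size (A_terms_of 1 2 1) = 4%N & size (A_terms_of 2 1 1) = 9%N] /\
  ((size (A_terms_of 2 2 1) + size (A_terms_of 1 2 2)
      + size (A_terms_of 2 1 2))
   + size (A_terms_of 1 1 1) + size (A_terms_of 1 1 2)
   + size (A_terms_of 1 2 1) + size (A_terms_of 2 1 1))%N = size A_terms.
Proof. by rewrite /A_terms_of A_termsE; vm_compute. Qed.

Theorem mainTheorem1 (R : realType) (n : nat) (N : affine_manifold R n)
    (P : bivector N) (c : chart R n N) (hc : atlas c) :
  op_eq c (assoc3 P c) (gsum_eval P c A_terms) /\
  size A_terms = 39%N /\
  [/\ size (A_terms_of 2 2 1) = 3%N, size (A_terms_of 1 2 2) = 3%N &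
      size (A_terms_of 2 1 2) = 3%N] /\
  [/\ size (A_terms_of 1 1 1) = 8%N, size (A_terms_of 1 1 2) = 9%N,
      size (A_terms_of 1 2 1) = 4%N & size (A_terms_of 2 1 1) = 9%N] /\
  ((size (A_terms_of 2 2 1) + size (A_terms_of 1 2 2)
      + size (A_terms_of 2 1 2))
   + size (A_terms_of 1 1 1) + size (A_terms_of 1 1 2)
   + size (A_terms_of 1 2 1) + size (A_terms_of 2 1 1))%N = size A_terms /\
  exists A Sf Sg Sh If Ig Ih : symbol N,
    op_eq c (assoc3 P c) (op_of c A) /\
    [/\ op_eq c (S_f P c) (op_of c Sf), op_eq c (S_g P c) (op_of c Sg) &
        op_eq c (S_h P c) (op_of c Sh)] /\
    [/\ op_eq c (I_f P c) (op_of c If), op_eq c (I_g P c) (op_of c Ig) &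
        op_eq c (I_h P c) (op_of c Ih)] /\
    (forall i j k : nat,
      op_eq c (restr c A i j k) (gsum_eval P c (A_terms_of i j k))) /\
    [/\ op_eq c (restr c A 2 2 1) ((2 / 3) *: restr c Sf 2 2 1),
        op_eq c (restr c A 1 2 2) ((2 / 3) *: restr c Sg 1 2 2) &
        op_eq c (restr c A 2 1 2) (- (2 / 3) *: restr c Sh 2 1 2)] /\
    op_eq c (restr c A 1 1 1)
      ((1 / 6) *: ((restr c If 1 1 1 - tadpole_f P c)
                   - (restr c Ih 1 1 1 - tadpole_h P c))) /\
    op_eq c (restr c A 1 1 2)
      ((1 / 6) *: restr c If 1 1 2 + (1 / 6) *: restr c Ig 1 1 2
       - (1 / 3) *: restr c Sh 1 1 2) /\
    op_eq c (restr c A 1 2 1)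
      ((1 / 3) *: (restr c If 1 2 1 - restr c Ih 1 2 1)) /\
    op_eq c (restr c A 2 1 1)
      ((1 / 3) *: restr c Sf 2 1 1 - (1 / 6) *: restr c Ig 2 1 1
       - (1 / 6) *: restr c Ih 2 1 1) /\
    (poisson P ->
      [/\ op_eq c (S_f P c) 0, op_eq c (S_g P c) 0 & op_eq c (S_h P c) 0] /\
      [/\ op_eq c (I_f P c) 0, op_eq c (I_g P c) 0 & op_eq c (I_h P c) 0] /\
      (forall i j k : nat,
        [/\ op_eq c (restr c Sf i j k) 0, op_eq c (restr c Sg i j k) 0 &
            op_eq c (restr c Sh i j k) 0] /\
        [/\ op_eq c (restr c If i j k) 0, op_eq c (restr c Ig i j k) 0 &
            op_eq c (restr c Ih i j k) 0]) /\
      op_eq c (tadpole_f P c) 0 /\ op_eq c (tadpole_h P c) 0 /\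
      op_eq c (restr c A 1 1 1)
        ((1 / 6) *: (restr c If 1 1 1 - restr c Ih 1 1 1)) /\
      op_eq c (assoc3 P c) 0).
Proof.
have [AG ops] : associator_factorization P c.
  case: (posnP n) => [n0|n0]; first exact: (associator_factorization_dim0 P c n0).
  exact: (associator_factorization_pos P hc (fun=> Ordinal n0)).
have [size_A [size_S [size_I size_sum]]] := A_terms_sizes.
split; first exact: AG.
split; first exact: size_A.
split; first exact: size_S.
split; first exact: size_I.
split; first exact: size_sum.
exact: ops.
Qed.
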